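(* Let $\mathcal{H}=(C,F,D,G,\mathcal{M})$ be a geometric hybrid dynamical system satisfying the geometric hybrid basic conditions, and let $\phi$ be a complete and precompact solution to $\mathcal{H}$. Then the $\omega$-limit set $\Omega(\phi)$ is nonempty, compact and weakly invariant for $\mathcal{H}$, and, for each open neighborhood $\mathcal{U}$ of $\Omega(\phi)$, there exists $N>0$ such that $\phi(t,j)\in\mathcal{U}$ for all $(t,j)\in\operatorname{dom}\phi$ such that $t+j\ge N$.
   Context: **Hybrid systems.** A geometric hybrid dynamical system $\mathcal{H}=(C,F,D,G,\mathcal{M})$ is $\dot x\in F(x)$ for $x\in C$, $x^+\in G(x)$ for $x\in D$, where $\mathcal{M}$ is a finite-dimensional $C^1$-manifold (second countable, Hausdorff), $C,D\subset\mathcal{M}$, $F:\mathcal{M}\rightrightarrows \mathrm{T}\mathcal{M}$ is set-valued with $F(x)\subset \mathrm{T}_x\mathcal{M}$ for each $x$, and $G:\mathcal{M}\rightrightarrows\mathcal{M}$ is set-valued. For a set-valued map, $\operatorname{dom}$ is the set of points with nonempty value. **Solutions.** A compact hybrid time domain is a set $\bigcup_{j=0}^{J}[t_j,t_{j+1}]\times\{j\}\subset\mathbb{R}_{\ge0}\times\mathbb{N}$ with $0=t_0\le t_1\le\dots\le t_{J+1}$; a hybrid time domain is a union of compact hybrid time domains $E_0\subset E_1\subset\cdots$. A function $\gamma:I\to\mathcal{M}$ on an interval is locally absolutely continuous if $\psi\circ\gamma$ is locally absolutely continuous for each $C^1$-function $\psi:\mathcal{M}\to\mathbb{R}$. A hybrid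 arc is a function $\phi:\operatorname{dom}\phi\to\mathcal{M}$, with $\operatorname{dom}\phi$ a hybrid time domain, such that for each $j$, $t\mapsto\phi(t,j)$ is locally absolutely continuous on $I^j=\{t:(t,j)\in\operatorname{dom}\phi\}$. A hybrid arc $\phi$ is a solution to $\mathcal{H}$ if: $\phi(0,0)\in\overline{C}\cup D$; for each $j$ with $\operatorname{int}I^j\ne\varnothing$, $\phi(t,j)\in C$ for all $t\in\operatorname{int}I^j$ and $\frac{d\phi}{dt}(t,j)\in F(\phi(t,j))$ for almost all $t\in I^j$; and for each $(t,j)\in\operatorname{dom}\phi$ with $(t,j+1)\in\operatorname{dom}\phi$, $\phi(t,j)\in D$ and $\phi(t,j+1)\in G(\phi(t,j))$. A solution is maximal if it is not the restriction of another solution with strictly larger domain; complete if $\sup\{t:\exists j,(t,j)\in\operatorname{dom}\phi\}+\sup\{j:\exists t,(t,j)\in\operatorname{dom}\phi\}=\infty$; precompact if its range $\operatorname{rge}\phi$ has compact closure in $\mathcal{M}$. $\mathcal{S}_{\mathcal{H}}(K)$ is the set of maximal solutions with $\phi(0,0)\in K$. **Set-valued notions.** For sets $S_i$ in a topological manifold, $\limsup_i S_i$ is the set of points each of whose neighborhoods meets $S_i$ for infinitely many $i$. A set-valued map $F:\mathcal{M}\rightrightarrows\mathcal{N}$ between topological manifolds is outer semicontinuous if for each $x$, $\bigcup_{x_i\to x}\limsup_{i}F(x_i)\subset F(x)$; it is locally precompact if each $x\in\mathcal{M}$ has a neighborhood $\mathcal{U}$ such that $F(\mathcal{U})$ has compact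 closure. It is outer semicontinuous (locally precompact) relative to $S$ if the map equal to $F$ on $S$ and empty-valued off $S$ is outer semicontinuous (locally precompact). **Geometric hybrid basic conditions.** (A1) $\mathcal{M}$ is a $C^1$-manifold; (A2) $C$ and $D$ are closed in $\mathcal{M}$; (A3) $F$ is outer semicontinuous and locally precompact relative to $C$, $F(x)$ is convex for all $x\in C$, and $C\subset\operatorname{dom}F$; (A4) $G$ is outer semicontinuous and locally precompact relative to $D$, and $D\subset\operatorname{dom}G$. **Invariance and $\omega$-limit sets.** $\Omega(\phi)$ is the set of $x\in\mathcal{M}$ for which there is a sequence $(t_i,j_i)\in\operatorname{dom}\phi$ with $t_i+j_i\to\infty$ and $\phi(t_i,j_i)\to x$. A nonempty set $K\subset\mathcal{M}$ is weakly forward invariant if for each $\xi\in K$ there is a complete $\phi\in\mathcal{S}_{\mathcal{H}}(\{\xi\})$ with $\operatorname{rge}\phi\subset K$; weakly backward invariant if for each $\xi\in K$ and $N>0$ there is $\phi\in\mathcal{S}_{\mathcal{H}}(K)$ and $(t^\star,j^\star)\in\operatorname{dom}\phi$ with $t^\star+j^\star\ge N$, $\phi(t^\star,j^\star)=\xi$ and $\phi(t,j)\in K$ for all $(t,j)\in\operatorname{dom}\phi$ with $t+j\le t^\star+j^\star$; weakly invariant if both. *)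

(* Defs.v *)
From HB Require Import structures.
From mathcomp Require Import all_boot all_order all_algebra.
From mathcomp Require Import all_classical all_reals all_analysis.

Set Implicit Arguments.
Unset Strict Implicit.
Unset Printing Implicit Defensive.

Import Order.TTheory GRing.Theory Num.Theory.
Import numFieldNormedType.Exports.

Local Open Scope classical_set_scope.
Local Open Scope ring_scope.

(* The set O is meant to be open, so that differentiability at the points of O
   does not depend on the values of f off O. In finite dimension, continuity of
   y |-> 'd f y v for every fixed v is continuity of y |-> 'd f y. *)
Definition C1_on (R : realType) (n : nat) (W : normedModType R)
    (O : set 'rV[R]_n) (f : 'rV[R]_n -> W) : Prop :=
  forall y, O y -> differentiable f y /\
    forall v : 'rV[R]_n, {for y, continuous (fun z => 'd f z v)}.

(* The atlas is not required to be maximal: it generates the C^1 structure.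
   The charts and their inverses are total functions, whose values off
   chart_dom i and off its image are irrelevant. *)
Record C1manifold (R : realType) (n : nat) := {
  mfd_space :> topologicalType;
  mfd_hausdorff : hausdorff_space mfd_space;
  mfd_second_countable : @second_countable mfd_space;
  chart_index : Type;
  chart_dom : chart_index -> set mfd_space;
  chart : chart_index -> mfd_space -> 'rV[R]_n;
  chart_inv : chart_index -> 'rV[R]_n -> mfd_space;
  chart_cover : forall x, exists i, chart_dom i x;
  chart_dom_open : forall i, open (chart_dom i);
  chart_image_open : forall i, open (chart i @` chart_dom i);
  chartK : forall i x, chart_dom i x -> chart_inv i (chart i x) = x;
  chart_continuous : forall i x, chart_dom i x ->
    {for x, continuous (chart i)};
  chart_inv_continuous : forall i x, chart_dom i x ->
    {for chart i x, continuous (chart_inv i)};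
  chart_C1 : forall i j,
    C1_on (chart i @` (chart_dom i `&` chart_dom j)) (chart j \o chart_inv i)
}.

Definition C1_function (R : realType) (n : nat) (M : C1manifold R n)
    (psi : M -> R) : Prop :=
  forall i : chart_index M,
    C1_on (chart i @` chart_dom i) (psi \o chart_inv i : 'rV[R]_n -> R^o).

(* A tangent vector is given by its base point and its components in all the
   charts around it, related by the differentials of the changes of charts.
   The components in the other charts are set to 0, so that they carry no
   information and the tangent space at x is a linear subspace of
   chart_index M -> 'rV[R]_n. *)
Record tangent_bundle (R : realType) (n : nat) (M : C1manifold R n) := {
  tangent_base : M;
  tangent_comp : chart_index M -> 'rV[R]_n;
  tangent_compE : forall i j,
    chart_dom i tangent_base -> chart_dom j tangent_base ->
    tangent_comp j =
      'd (chart j \o chart_inv i) (chart i tangent_base) (tangent_comp i);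
  tangent_comp_out : forall i, ~ chart_dom i tangent_base -> tangent_comp i = 0
}.

HB.instance Definition _ (R : realType) (n : nat) (M : C1manifold R n) :=
  gen_eqMixin (tangent_bundle M).
HB.instance Definition _ (R : realType) (n : nat) (M : C1manifold R n) :=
  gen_choiceMixin (tangent_bundle M).

Definition bundle_chart (R : realType) (n : nat) (M : C1manifold R n)
    (i : chart_index M) (w : tangent_bundle M) : 'rV[R]_n * 'rV[R]_n :=
  (chart i (tangent_base w), tangent_comp w i).

Definition bundle_chart_preimage (R : realType) (n : nat) (M : C1manifold R n)
    (i : chart_index M) (O : set ('rV[R]_n * 'rV[R]_n)) :
    set (tangent_bundle M) :=
  [set w | chart_dom i (tangent_base w) /\ O (bundle_chart i w)].

(* Topology of the tangent bundle: the preimages of open sets under the bundle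
   charts form a subbase (in fact a base). *)
HB.instance Definition _ (R : realType) (n : nat) (M : C1manifold R n) :=
  @isSubBaseTopological.Build (tangent_bundle M)
    (set (tangent_bundle M))
    [set W | exists i, exists2 O, open O & W = bundle_chart_preimage i O]
    id.

(* Convexity in the tangent space, the linear operations being those of the
   components. *)
Definition tangent_convex (R : realType) (n : nat) (M : C1manifold R n)
    (A : set (tangent_bundle M)) : Prop :=
  convex_set ((@tangent_comp R n M) @` A
    : set (convex_lmodType (chart_index M -> 'rV[R]_n))).

(* gamma t is only relevant for t in some interval; the derivative below is the
   intended one at interior points of that interval. *)
Definition is_velocity (R : realType) (n : nat) (M : C1manifold R n)
    (gamma : R -> M) (t : R) (w : tangent_bundle M) : Prop :=
  tangent_base w = gamma t /\
  forall i, chart_dom i (gamma t) ->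
    is_derive (t : R^o) 1 (chart i \o gamma : R^o -> 'rV[R]_n)
      (tangent_comp w i).

Definition abs_continuous_on (R : realType) (a b : R) (f : R -> R) : Prop :=
  forall e, 0 < e -> exists2 d, 0 < d &
    forall (m : nat) (s t : 'I_m -> R),
      (forall k, [/\ a <= s k, s k <= t k & t k <= b]) ->
      (forall k l, k != l -> t k <= s l \/ t l <= s k) ->
      \sum_(k < m) (t k - s k) < d ->
      \sum_(k < m) `|f (t k) - f (s k)| < e.

Definition loc_abs_continuous (R : realType) (n : nat) (M : C1manifold R n)
    (I : set R) (gamma : R -> M) : Prop :=
  forall psi : M -> R, C1_function psi ->
  forall a b, a <= b -> `[a, b] `<=` I -> abs_continuous_on a b (psi \o gamma).

Definition limsup_set (T : topologicalType) (S : nat -> set T) : set T :=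
  [set p | forall U, nbhs p U -> infinite_set [set i | U `&` S i !=set0]].

Definition set_valued_dom (T U : Type) (F : T -> set U) : set T :=
  [set x | F x !=set0].

Definition outer_semicontinuous (T U : topologicalType) (F : T -> set U) :
    Prop :=
  forall (x : T) (u : nat -> T), u @ \oo --> x ->
    limsup_set (F \o u) `<=` F x.

Definition locally_precompact (T U : topologicalType) (F : T -> set U) : Prop :=
  forall x : T, exists2 V, nbhs x V & precompact (\bigcup_(y in V) F y).

Definition set_valued_restrict (T U : Type) (S : set T) (F : T -> set U) :
    T -> set U :=
  fun x => [set y | S x /\ F x y].

Record hybrid_system (R : realType) (n : nat) (M : C1manifold R n) := {
  flow_set : set M;
  flow_map : M -> set (tangent_bundle M);
  jump_set : set M;
  jump_map : M -> set M;
  flow_map_tangent : forall x w, flow_map x w -> tangent_base w = x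
}.

Record hybrid_basic_conditions (R : realType) (n : nat) (M : C1manifold R n)
    (H : hybrid_system M) : Prop := {
  flow_set_closed : closed (flow_set H);
  jump_set_closed : closed (jump_set H);
  flow_map_osc :
    outer_semicontinuous (set_valued_restrict (flow_set H) (flow_map H));
  flow_map_precompact :
    locally_precompact (set_valued_restrict (flow_set H) (flow_map H));
  flow_map_convex : forall x, flow_set H x -> tangent_convex (flow_map H x);
  flow_set_dom : flow_set H `<=` set_valued_dom (flow_map H);
  jump_map_osc :
    outer_semicontinuous (set_valued_restrict (jump_set H) (jump_map H));
  jump_map_precompact :
    locally_precompact (set_valued_restrict (jump_set H) (jump_map H));
  jump_set_dom : jump_set H `<=` set_valued_dom (jump_map H)
}.

Definition compact_hybrid_time_domain (R : realType) (E : set (R * nat)) :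
    Prop :=
  exists (J : nat) (t : nat -> R),
    [/\ t 0%N = 0,
        forall j, (j <= J)%N -> t j <= t j.+1 &
        E = [set p | (p.2 <= J)%N /\ t p.2 <= p.1 <= t p.2.+1]].

Definition hybrid_time_domain (R : realType) (E : set (R * nat)) : Prop :=
  exists Es : nat -> set (R * nat),
    [/\ forall k, compact_hybrid_time_domain (Es k),
        forall k, Es k `<=` Es k.+1 &
        E = \bigcup_k Es k].

(* A function from arc_dom to M; the values of arc_fun off arc_dom are
   irrelevant. *)
Record partial_arc (R : realType) (n : nat) (M : C1manifold R n) := {
  arc_dom : set (R * nat);
  arc_fun :> R -> nat -> M
}.

Definition arc_slice (R : realType) (n : nat) (M : C1manifold R n)
    (phi : partial_arc M) (j : nat) : set R :=
  [set t | arc_dom phi (t, j)].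

Definition arc_range (R : realType) (n : nat) (M : C1manifold R n)
    (phi : partial_arc M) : set M :=
  [set phi p.1 p.2 | p in arc_dom phi].

Definition hybrid_arc (R : realType) (n : nat) (M : C1manifold R n)
    (phi : partial_arc M) : Prop :=
  hybrid_time_domain (arc_dom phi) /\
  forall j, loc_abs_continuous (arc_slice phi j) (phi^~ j).

Record solution (R : realType) (n : nat) (M : C1manifold R n)
    (H : hybrid_system M) (phi : partial_arc M) : Prop := {
  solution_arc : hybrid_arc phi;
  solution_init : (closure (flow_set H) `|` jump_set H) (phi 0 0%N);
  solution_flow_set : forall j, (arc_slice phi j)° !=set0 ->
    forall t, (arc_slice phi j)° t -> flow_set H (phi t j);
  solution_flow : forall j, (arc_slice phi j)° !=set0 ->
    {ae @lebesgue_measure R, forall t, arc_slice phi j t ->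
      exists2 w, is_velocity (phi^~ j) t w & flow_map H (phi t j) w};
  solution_jump : forall t j, arc_dom phi (t, j) -> arc_dom phi (t, j.+1) ->
    jump_set H (phi t j) /\ jump_map H (phi t j) (phi t j.+1)
}.

Definition maximal_solution (R : realType) (n : nat) (M : C1manifold R n)
    (H : hybrid_system M) (phi : partial_arc M) : Prop :=
  solution H phi /\
  ~ exists psi : partial_arc M,
      [/\ solution H psi, arc_dom phi `<` arc_dom psi &
          forall t j, arc_dom phi (t, j) -> phi t j = psi t j].

Definition maximal_solutions_from (R : realType) (n : nat) (M : C1manifold R n)
    (H : hybrid_system M) (K : set M) : set (partial_arc M) :=
  [set phi | maximal_solution H phi /\ K (phi 0 0%N)].

Definition complete_arc (R : realType) (n : nat) (M : C1manifold R n)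
    (phi : partial_arc M) : Prop :=
  (ereal_sup [set p.1%:E | p in arc_dom phi] +
   ereal_sup [set p.2%:R%:E | p in arc_dom phi] = +oo)%E.

Definition precompact_arc (R : realType) (n : nat) (M : C1manifold R n)
    (phi : partial_arc M) : Prop :=
  precompact (arc_range phi).

Definition omega_limit (R : realType) (n : nat) (M : C1manifold R n)
    (phi : partial_arc M) : set M :=
  [set x | exists (t : nat -> R) (j : nat -> nat),
    [/\ forall i, arc_dom phi (t i, j i),
        (fun i => t i + (j i)%:R) @ \oo --> +oo &
        (fun i => phi (t i) (j i)) @ \oo --> x]].

Definition weakly_forward_invariant (R : realType) (n : nat)
    (M : C1manifold R n) (H : hybrid_system M) (K : set M) : Prop :=
  K !=set0 /\
  forall xi, K xi -> exists phi : partial_arc M,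
    [/\ maximal_solutions_from H [set xi] phi, complete_arc phi &
        arc_range phi `<=` K].

Definition weakly_backward_invariant (R : realType) (n : nat)
    (M : C1manifold R n) (H : hybrid_system M) (K : set M) : Prop :=
  K !=set0 /\
  forall (xi : M) (N : R), K xi -> 0 < N ->
  exists (phi : partial_arc M) (ts : R) (js : nat),
    [/\ maximal_solutions_from H K phi,
        arc_dom phi (ts, js),
        N <= ts + js%:R,
        phi ts js = xi &
        forall t j, arc_dom phi (t, j) -> t + j%:R <= ts + js%:R ->
          K (phi t j)].

Definition weakly_invariant (R : realType) (n : nat) (M : C1manifold R n)
    (H : hybrid_system M) (K : set M) : Prop :=
  weakly_forward_invariant H K /\ weakly_backward_invariant H K.

(* Main.v *)
Require Import Defs.
From HB Require Import structures.
From mathcomp Require Import all_boot all_order all_algebra.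
From mathcomp Require Import finmap.
From mathcomp Require Import all_classical all_reals all_analysis.
From mathcomp Require Import measurable_realfun ring lra.
Set Implicit Arguments.
Unset Strict Implicit.
Unset Printing Implicit Defensive.
Import Order.TTheory GRing.Theory Num.Theory.
Import numFieldNormedType.Exports.
Local Open Scope classical_set_scope.
Local Open Scope ring_scope.

(** The omega-limit set consists of the cluster values of the arc at infinite
hybrid time ([omega_limitP]); that it is nonempty, compact and attracting is
then a compactness argument, as the arc stays in a compact set. The substance
is weak invariance. Let xi be a limit of points phi(s_i, k_i) with s_i + k_i
tending to infinity, and shift the time origin of phi: to (s_i, k_i) for forward
invariance, and to a point of the domain preceding (s_i, k_i) by at least N and
at most N + 1 for backward invariance ([domain_step_back]). The shifted arcs
converge to an arc which is a complete solution, runs in the omega-limit set and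
passes through xi, at the origin or at a time at least N
([omega_limit_solution]). Since a complete solution is maximal
([complete_solution_maximal]), this is weak invariance.

The limit is taken along an ultrafilter on the indices, which replaces the
extraction of subsequences: jump times converge in the extended real line and
points converge in the compact closure of the range. That the limit is a solution
([limit_arc_solution]) rests on two facts.

Equicontinuity: for each C1 function psi on the manifold, psi o phi(., j) is
Lipschitz with a constant independent of j ([solution_C1_lipschitz]), since the
flow map is bounded in charts near each point and the range is relatively
compact. C1 functions separate points and determine the topology, because there
are enough of them with small support ([cutoff]); so the limit arc is well
defined, and inherits these Lipschitz bounds. It follows that it is absolutely
continuous and, in charts, almost everywhere differentiable
([lipschitz_ae_derivable]).

Inclusion: at every time of differentiability t, with x the value of the limit
arc at t, the derivative lies in F(x) ([limit_arc_derivative]). Indeed F is upper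
semicontinuous in a chart ([flow_map_usc]), so that near t the velocities of the
approximating arcs lie in a neighborhood of the compact convex set F(x). By a
mean value theorem for absolutely continuous maps ([mean_value_convex]) so do
their difference quotients, hence the difference quotients of the limit arc; let
the step and the neighborhood shrink. *)

(** * Induction over intervals; derivatives by error estimates *)

(** Cousin's lemma as an induction principle: the supremum of the x such
that P a x holds belongs to this set and cannot lie below b. In the local
hypothesis only intervals containing the point t are tested, as in tagged
partitions. *)
Lemma cousin_induction (R : realType) (P : R -> R -> Prop) (a b : R) :
  a <= b ->
  (forall u c v, a <= u -> u <= c -> c <= v -> v <= b ->
    P u c -> P c v -> P u v) ->
  (forall t, a <= t <= b -> exists2 d, 0 < d &
    forall u v, a <= u -> u <= t -> t <= v -> v <= b -> v - u < d -> P u v) ->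
  P a b.
Proof.
move=> ab Padd Ploc.
pose S := [set x | a <= x <= b /\ P a x].
have Sa : S a.
  split; first by rewrite lexx ab.
  have /Ploc [d d0] : a <= a <= b by rewrite lexx ab.
  by apply => //; rewrite subrr.
have Sub : ubound S b by move=> x [/andP[]].
have hS : has_sup S by split; [exists a|exists b].
have as_ : a <= sup S by apply: sup_upper_bound.
have sb : sup S <= b by apply: sup_le_ub => //; exists a.
have /Ploc [d d0 Pd] : a <= sup S <= b by rewrite as_ sb.
have [x [/andP[ax xb] Pax] xs] : exists2 x, S x & sup S - d / 2 < x.
  by apply: sup_adherent => //; rewrite divr_gt0.
have xs' : x <= sup S by apply: sup_upper_bound => //; split=> //; rewrite ax xb.
pose y := Num.min b (sup S + d / 3).
have sy : sup S <= y by rewrite le_min sb lerDl divr_ge0// ltW.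
have yb : y <= b by rewrite ge_min lexx.
have Pay : P a y.
  apply: (Padd a x y) => //; first exact: le_trans sy.
  apply: Pd => //.
  have : y <= sup S + d / 3 by rewrite ge_min lexx orbT.
  by lra.
have ys : y <= sup S.
  by apply: sup_upper_bound => //; split=> //; rewrite yb (le_trans as_ sy).
suff -> : b = y by [].
by move: ys; rewrite /y minEle; case: ifP => // _; lra.
Qed.

Section derive_char.
Variables (R : realType) (W : normedModType R).

Lemma is_deriveP (f : R^o -> W) (t : R) (w : W) :
  is_derive (t : R^o) 1 f w <->
  (forall e, 0 < e -> exists2 d, 0 < d & forall s, `|s - t| < d ->
     `|f s - f t - (s - t) *: w| <= e * `|s - t|).
Proof.
have E (h : R) : h *: (1 : R^o) = h by rewrite /GRing.scale/= mulr1.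
split=> [[dft dv] e e0|H].
- have /cvgrPdist_le/(_ e e0) : (fun h : R => h^-1 *: ((f \o shift (t:R^o)) (h *: (1 : R^o)) - f t)) @ 0^' --> w.
    by rewrite -dv; exact: dft.
  move=> /nbhs_ballP[d/= d0 dH]; exists d => // s st.
  have [->|nst] := eqVneq s t; first by rewrite !subrr scale0r subrr !normr0 mulr0.
  have nst0 : s - t != 0 by rewrite subr_eq0.
  have := dH (s - t); rewrite /ball/= sub0r normrN => /(_ st nst0).
  rewrite E/= subrK => hh.
  rewrite -ler_pdivrMr ?normr_gt0// -normfV mulrC -normrZ scalerBr scalerA.
  by rewrite mulVf// scale1r -normrN opprB.
- have cv : (fun h : R => h^-1 *: ((f \o shift (t:R^o)) (h *: (1 : R^o)) - f t)) @ 0^' --> w.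
    apply/cvgrPdist_le => e e0; have [d d0 dH] := H _ e0.
    apply/nbhs_ballP; exists d => //= h; rewrite /ball/= sub0r normrN => hd h0.
    have := dH (h + t); rewrite E addrK => /(_ hd) hh.
    have -> : w - h^-1 *: (f (h + t) - f t) = - (h^-1 *: (f (h + t) - f t - h *: w)).
      by rewrite [in RHS]scalerBr scalerA mulVf// scale1r opprB.
    by rewrite normrN normrZ normfV ler_pdivrMl ?normr_gt0// mulrC.
  have df : derivable f (t : R^o) 1 by apply/cvg_ex; exists w.
  by apply: DeriveDef => //; apply/cvg_lim.
Qed.

End derive_char.

(** * Absolute continuity along finite families of intervals *)

Definition convex_in (R : realType) (W : normedModType R) (K : set W) :=
  forall (s t : R) x y, 0 <= s -> 0 <= t -> s + t = 1 -> K x -> K y ->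
    K (s *: x + t *: y).

(** The families of intervals are ordered lists, which concatenate when two
adjacent intervals are joined in [mean_value_convex]. *)
Definition abs_continuous_seq (R : realType) (W : normedModType R)
    (a b : R) (f : R -> W) : Prop :=
  forall e, 0 < e -> exists2 d, 0 < d & forall l : seq (R * R),
    all (fun p => [&& a <= p.1, p.1 <= p.2 & p.2 <= b]) l ->
    pairwise (fun p q => p.2 <= q.1) l ->
    \sum_(p <- l) (p.2 - p.1) < d ->
    \sum_(p <- l) `|f p.2 - f p.1| < e.

Lemma abs_continuous_on_seq (R : realType) (a b : R) (f : R -> R) :
  abs_continuous_on a b f -> abs_continuous_seq a b (f : R -> R^o).
Proof.
move=> fac e /fac[d d0 fd]; exists d => // l la lp ld.
pose nthl (k : 'I_(size l)) := nth (0, 0) l k.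
rewrite (big_nth (0, 0)) big_mkord; apply: (fd _ (fun k => (nthl k).1) (fun k => (nthl k).2)).
- by move=> k; have /(all_nthP (0, 0))/(_ k (ltn_ord k))/and3P[] := la.
- move=> k m km; have /(pairwiseP (0, 0)) H := lp.
  have [km'|mk|/val_inj kmE] := ltngtP k m; last by rewrite kmE eqxx in km.
  + by left; apply: (H k m); rewrite ?inE ?ltn_ord.
  + by right; apply: (H m k); rewrite ?inE ?ltn_ord.
- by rewrite (big_nth (0, 0)) big_mkord in ld.
Qed.

Lemma norm_rV_le_sum (R : realType) (n : nat) (v : 'rV[R]_n) :
  `|v| <= \sum_(k < n) `|v 0 k|.
Proof.
rewrite [leLHS]/Num.norm/= mx_normrE; apply/bigmax_leP; split=> [|[i j] _ /=].
  exact: sumr_ge0.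
by rewrite ord1 (bigD1 j)//= lerDl sumr_ge0.
Qed.

Lemma coord_norm_le (R : realType) (n : nat) (v : 'rV[R]_n) (k : 'I_n) :
  `|v 0 k| <= `|v|.
Proof.
rewrite [leRHS]/Num.norm/= mx_normrE.
exact: (le_bigmax _ (fun ij => `|v ij.1 ij.2|) (0, k)).
Qed.

Lemma abs_continuous_seq_rV (R : realType) (n : nat) (a b : R)
    (f : R -> 'rV[R]_n) :
  (forall k, abs_continuous_seq a b (fun t => f t 0 k : R^o)) ->
  abs_continuous_seq a b f.
Proof.
move=> fac e e0.
have en0 : 0 < e / n.+1%:R by rewrite divr_gt0.
have /choice[d dP] : forall k, exists d, 0 < d /\ forall l : seq (R * R),
    all (fun p => [&& a <= p.1, p.1 <= p.2 & p.2 <= b]) l ->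
    pairwise (fun p q => p.2 <= q.1) l ->
    \sum_(p <- l) (p.2 - p.1) < d ->
    \sum_(p <- l) `|f p.2 0 k - f p.1 0 k| < e / n.+1%:R.
  by move=> k; have [d d0 dP] := fac k _ en0; exists d; split.
exists (\big[Num.min/1]_k d k).
  by elim/big_ind : _ => // [x y x0 y0|k _]; [rewrite lt_min x0|case: (dP k)].
move=> l la lp ld.
apply: (@le_lt_trans _ _ (\sum_(k < n) \sum_(p <- l) `|f p.2 0 k - f p.1 0 k|)).
  rewrite exchange_big/=; apply: ler_sum => p _.
  by apply: le_trans (norm_rV_le_sum _) _; apply: ler_sum => k _; rewrite !mxE.
apply: (@le_lt_trans _ _ (\sum_(k < n) e / n.+1%:R)).
  apply: ler_sum => k _; apply/ltW; case: (dP k) => _; apply => //.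
  by apply: lt_le_trans ld _; apply: bigmin_le_cond.
rewrite sumr_const card_ord -[ltLHS]mulr_natr -mulrA gtr_pMr// mulrC.
by rewrite ltr_pdivrMr// mul1r ltr_nat.
Qed.

Lemma abs_continuous_seq_ext (R : realType) (W : normedModType R) (a b : R)
    (f g : R -> W) : (forall t, a <= t <= b -> f t = g t) ->
  abs_continuous_seq a b f -> abs_continuous_seq a b g.
Proof.
move=> fg fac e /fac[d d0 fd]; exists d => // l la lp ld.
have := fd l la lp ld; rewrite !big_seq; congr (_ < _).
apply: eq_bigr => p pl; have /allP/(_ p pl)/and3P[a1 a2 a3] := la.
by rewrite !fg// ?a1 ?a3 ?(le_trans a1 a2)// (le_trans a2 a3).
Qed.

Lemma lipschitz_abs_continuous (R : realType) (a b L : R) (f : R -> R) :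
  0 <= L ->
  (forall s t, a <= s -> s <= t -> t <= b -> `|f t - f s| <= L * (t - s)) ->
  abs_continuous_on a b f.
Proof.
move=> L0 fL e e0; have L10 : 0 < L + 1 by rewrite ltr_wpDl.
exists (e / (L + 1)); first by rewrite divr_gt0.
move=> m s t st _ sm.
apply: (@le_lt_trans _ _ (\sum_(k < m) L * (t k - s k))).
  by apply: ler_sum => k _; have [? ? ?] := st k; exact: fL.
rewrite -mulr_sumr.
have S0 : 0 <= \sum_(k < m) (t k - s k).
  by apply: sumr_ge0 => k _; have [_ ? _] := st k; rewrite subr_ge0.
apply: (@le_lt_trans _ _ ((L + 1) * \sum_(k < m) (t k - s k))).
  by apply: ler_wpM2r => //; rewrite lerDl.
by rewrite mulrC -ltr_pdivlMr.
Qed.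

(** * Mean values of absolutely continuous maps *)

Section mvt.
Variables (R : realType).
Notation mu := (@lebesgue_measure R).

Lemma negligible_open_cover (N : set R) (d : R) : 0 < d ->
  mu.-negligible N ->
  exists U : set R, [/\ open U, N `<=` U & (mu U < d%:E)%E].
Proof.
move=> d0 [A [mA A0 NA]].
have Aoo : (mu A < +oo)%E by rewrite A0 ltry.
have [U [oU AU Ud]] := lebesgue_regularity_outer mA Aoo d0.
exists U; split => //; first exact: subset_trans AU.
have mU : measurable U by exact: open_measurable.
rewrite -(setDUK AU) measureU//.
- by rewrite [X in (X + _ < _)%E]A0 add0e.
- exact: measurableD.
- by rewrite setDIK.
Qed.

Lemma ae_imply (P Q : R -> Prop) :
  {ae mu, forall t, P t} -> (forall t, P t -> Q t) -> {ae mu, forall t, Q t}.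
Proof.
by move=> aP PQ; apply: filterS aP; first exact: (ae_filter_ringOfSetsType mu).
Qed.

Lemma ae_imply2 (P Q S : R -> Prop) :
  {ae mu, forall t, P t} -> {ae mu, forall t, Q t} ->
  (forall t, P t -> Q t -> S t) -> {ae mu, forall t, S t}.
Proof.
move=> aP aQ PQS; apply: filterS2 aP aQ; first exact: (ae_filter_ringOfSetsType mu).
exact: PQS.
Qed.

Lemma ae_true (P : R -> Prop) : (forall t, P t) -> {ae mu, forall t, P t}.
Proof. by move=> aP; apply: filterE; first exact: (ae_filter_ringOfSetsType mu). Qed.

Lemma ae_neq (x : R) : {ae mu, forall t, t != x}.
Proof.
exists [set x]; split => //; first exact: lebesgue_measure_set1.
by move=> t /= /negP/negbNE/eqP ->.
Qed.

Lemma ae_forall_nat (P : nat -> R -> Prop) :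
  (forall k, {ae mu, forall t, P k t}) ->
  {ae mu, forall t, forall k, P k t}.
Proof.
move=> aP; have := negligible_bigcup (mu := mu) aP.
rewrite /almost_everywhere /prop_near1 /= => h.
by apply: negligibleS h => t /existsNP[k nk]; exists k.
Qed.

Lemma ae_forall_fin (I : finType) (P : I -> R -> Prop) :
  (forall i, {ae mu, forall t, P i t}) -> {ae mu, forall t, forall i, P i t}.
Proof. exact: (@filter_forall _ _ _ _ (ae_filter_ringOfSetsType mu)). Qed.

(** The argument is that of the Henstock integral. The exceptional null set N is
covered by an open set U of small measure. Every small interval tagged by a point
off N has an increment close to its length times an element of K; an interval
tagged by a point of N is stored in a list of intervals inside U. Gluing small
intervals by [cousin_induction] gives this description for [a, b] itself, the
contributions of K being averaged by convexity; absolute continuity then bounds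
the total increment over the list. *)
Theorem mean_value_convex (W : normedModType R) (f : R -> W) (K : set W)
    (a b : R) :
  a <= b -> convex_in K -> K !=set0 -> abs_continuous_seq a b f ->
  {ae mu, forall t, a < t < b ->
    exists2 w, is_derive (t : R^o) 1 (f : R^o -> W) w & K w} ->
  forall e, 0 < e ->
  exists2 w, K w & `|f b - f a - (b - a) *: w| <= e.
Proof.
move=> ab cK [w0 Kw0] fac fd e e0.
pose N := ~` [set t | a < t < b ->
  exists2 w, is_derive (t : R^o) 1 (f : R^o -> W) w & K w] `|` [set a; b].
have nN : mu.-negligible N.
  apply: negligibleU; first exact: fd.
  have n1 (x : R) : mu.-negligible [set x].
    by exists [set x]; split => //; exact: lebesgue_measure_set1.
  exact: negligibleU.
have e20 : 0 < e / 4 by rewrite divr_gt0.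
have [d d0 dP] := fac _ e20.
(* On the stored intervals the missing slope is taken to be w0; the second term
   of the minimum makes their share of (b - a) *: w negligible. *)
pose d' := Num.min d (e / 4 / (1 + `|w0|)).
have w10 : 0 < 1 + `|w0| by rewrite ltr_pwDl.
have d'0 : 0 < d' by rewrite lt_min d0 divr_gt0.
have [U [oU NU Ud]] := negligible_open_cover d'0 nN.
pose len (l : seq (R * R)) := \sum_(p <- l) (p.2 - p.1).
pose inc (l : seq (R * R)) := \sum_(p <- l) (f p.2 - f p.1 - (p.2 - p.1) *: w0).
pose e' := e / 2 / (b - a + 1).
have ba0 : 0 < b - a + 1 by rewrite ltr_wpDl ?subr_ge0.
have e'0 : 0 < e' by rewrite !divr_gt0.
pose P u v := u <= v -> exists (l : seq (R * R)) w,
  [/\ all (fun p => [&& u <= p.1, p.1 <= p.2 & p.2 <= v]) l,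
      pairwise (fun p q => p.2 <= q.1) l,
      ((len l)%:E <= mu (U `&` `[u, v[))%E, K w &
      `|f v - f u - inc l - (v - u) *: w| <= e' * (v - u)].
suff /(_ ab) [l [w [la lp lU Kw lw]]] : P a b.
  have lend' : len l < d'.
    rewrite -lte_fin; apply: le_lt_trans lU (le_lt_trans _ Ud).
    apply: le_measure; rewrite ?inE//; last by apply: open_measurable.
    by apply: measurableI => //; exact: open_measurable.
  have lend : len l < d by apply: lt_le_trans lend' _; rewrite ge_min lexx.
  have lenw : len l * `|w0| <= e / 4.
    apply: (@le_trans _ _ (d' * (1 + `|w0|))).
      apply: ler_pM => //; first last.
      - by rewrite lerDr.
      - exact: ltW.
      - rewrite /len big_seq; apply: sumr_ge0 => p pl.
        by have /allP/(_ _ pl)/and3P[_ ? _] := la; rewrite subr_ge0.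
    by rewrite -ler_pdivlMr// /d' ge_min lexx orbT.
  exists w => //.
  have -> : f b - f a - (b - a) *: w = (f b - f a - inc l - (b - a) *: w) + inc l.
    by rewrite [RHS]addrAC subrK.
  have -> : e = e' * (b - a + 1) + (e / 4 + e / 4).
    by rewrite /e' -mulrA mulVf ?gt_eqF//; lra.
  apply: le_trans (ler_normD _ _) _; apply: lerD.
    by apply: le_trans lw _; rewrite ler_pM2l// lerDl.
  rewrite /inc sumrB -scaler_suml.
  apply: le_trans (ler_normD _ _) _; apply: lerD.
    by apply: le_trans (ler_norm_sum _ _ _) _; apply/ltW/dP.
  rewrite normrN normrZ ger0_norm//.
  rewrite big_seq; apply: sumr_ge0 => p pl.
  by have /allP/(_ _ pl)/and3P[_ ? _] := la; rewrite subr_ge0.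
have mUi (u v : R) : measurable (U `&` `[u, v[).
  by apply: measurableI => //; exact: open_measurable.
apply: (cousin_induction ab).
- move=> u c v au uc cv vb Puc Pcv uv.
  have [l1 [w1 [la1 lp1 lU1 Kw1 lw1]]] := Puc uc.
  have [l2 [w2 [la2 lp2 lU2 Kw2 lw2]]] := Pcv cv.
  have lenD : len (l1 ++ l2) = len l1 + len l2 by rewrite /len big_cat.
  have incD : inc (l1 ++ l2) = inc l1 + inc l2 by rewrite /inc big_cat.
  exists (l1 ++ l2).
  exists (if u == v then w1 else ((c - u) / (v - u)) *: w1 + ((v - c) / (v - u)) *: w2).
  split.
  + rewrite all_cat; apply/andP; split; apply/allP => p pl.
    * have /allP/(_ _ pl)/and3P[p1 p2 p3] := la1.
      by rewrite p1 p2 (le_trans p3).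
    * have /allP/(_ _ pl)/and3P[p1 p2 p3] := la2.
      by rewrite p3 p2 (le_trans _ p1).
  + rewrite pairwise_cat lp1 lp2 !andbT; apply/allrelP => p q pl ql.
    have /allP/(_ _ pl)/and3P[_ _ p3] := la1.
    have /allP/(_ _ ql)/and3P[q1 _ _] := la2.
    exact: le_trans p3 q1.
  + rewrite lenD EFinD; apply: le_trans (leeD lU1 lU2) _.
    have D0 : (U `&` `[u, c[) `&` (U `&` `[c, v[) = set0.
      rewrite setIACA; apply/seteqP; split=> // x [_ [/=]].
      by rewrite !in_itv/= => /andP[_ +] /andP[+ _]; move=> /lt_le_trans/[apply]; rewrite ltxx.
    apply: (@le_trans _ _ (mu ((U `&` `[u, c[) `|` (U `&` `[c, v[)))).
      by rewrite measureU//; exact: mUi.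
    apply: le_measure; rewrite ?inE; [by apply: measurableU; exact: mUi|exact: mUi|].
    rewrite -setIUr.
    apply: setIS => x [] /=; rewrite !in_itv/= => /andP[x1 x2]; apply/andP; split => //.
    * exact: lt_le_trans x2 cv.
    * exact: le_trans x1.
  + case: eqP => // uv'; have vu0 : 0 < v - u by rewrite subr_gt0 lt_neqAle uv andbT; apply/eqP.
    apply: cK => //; rewrite ?divr_ge0 ?subr_ge0//.
    by rewrite -mulrDl addrC subrKA divff// gt_eqF.
  + have -> : (v - u) *: (if u == v then w1 else ((c - u) / (v - u)) *: w1 + ((v - c) / (v - u)) *: w2) = (c - u) *: w1 + (v - c) *: w2.
      case: eqP => [uv'|/eqP uv'].
        have cu : c = u by apply/le_anti; rewrite uc andbT uv'.
        by rewrite -uv' cu !subrr !scale0r addr0.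
      have vu0 : v - u != 0 by rewrite subr_eq0 eq_sym.
      by rewrite scalerDr !scalerA ![(v - u) * _]mulrC !divfK.
    have -> : e' * (v - u) = e' * (c - u) + e' * (v - c) by ring.
    rewrite incD.
    apply: le_trans (lerD lw1 lw2); apply: le_trans (ler_normD _ _).
    rewrite le_eqVlt; apply/orP; left; apply/eqP; congr (`| _ |).
    rewrite !opprD !addrA.
    by rewrite [RHS](ACl (1*6*5*2*3*7*4*8))/= subrr add0r.
- move=> t /andP[at_ tb].
  have [tN|tN] := pselect (N t).
  + have /nbhs_ballP[r /= r0 rU] : nbhs t U by apply: open_nbhs_nbhs; split=> //; exact: NU.
    exists r => // u v au ut tv vb vur uv.
    exists [:: (u, v)], w0; split => //=.
    * by rewrite uv !lexx.
    * rewrite /len big_seq1/=.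
      have -> : U `&` `[u, v[ = `[u, v[%classic.
        apply/setIidPr => x /=; rewrite in_itv/= => /andP[ux xv]; apply: rU.
        by rewrite /ball/= ltr_norml; lra.
      rewrite lebesgue_measure_itv/= lte_fin.
      by case: ltgtP uv => [//||->] //; rewrite subrr.
    * by rewrite /inc big_seq1/= subKr subrr normr0 mulr_ge0// ?subr_ge0// ltW.
  + move: tN => /not_orP[ntab Ht].
    have Hta : a < t < b.
      move: Ht => /not_orP[/eqP ta /eqP tb']; rewrite !lt_neqAle eq_sym ta at_/=.
      by rewrite tb' tb.
    have [w /is_deriveP/(_ e' e'0)[r r0 rw] Kw] := contrapT ntab Hta.
    exists r => // u v au ut tv vb vur uv.
    exists [::], w; rewrite /len /inc !big_nil; split => //=.
    have vr : `|v - t| < r by rewrite ltr_norml; lra.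
    have ur : `|u - t| < r by rewrite ltr_norml; lra.
    have := lerD (rw _ vr) (rw _ ur).
    rewrite [ `|v - t| ]ger0_norm ?subr_ge0// [ `|u - t| ]ler0_norm ?subr_le0//.
    have -> : e' * (v - t) + e' * - (u - t) = e' * (v - u) by ring.
    apply: le_trans; rewrite -[X in _ <= _ + X]normrN; apply: le_trans (ler_normD _ _).
    rewrite le_eqVlt; apply/orP; left; apply/eqP; congr (`| _ |).
    rewrite subr0 -(subrKA t v (- u)) scalerDl !opprD !opprK !addrA.
    rewrite [RHS](ACl (2*5*1*4*3*6))/= addNr add0r.
    by rewrite -[X in _ + X = _]scaleNr opprB.
Qed.

End mvt.

(** * Almost everywhere differentiability of Lipschitz functions *)

Section lipschitz_derivable.
Variables (R : realType).
Notation mu := (@lebesgue_measure R).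

Section stieltjes.
Variables (g : cumulative R R) (L : R).
Hypothesis g_lip : forall x y, x <= y -> g y - g x <= L * (y - x).

(** The growth condition bounds the Stieltjes length of an interval by L times its
length, hence the Stieltjes outer measure by L times the Lebesgue one. *)
Lemma stieltjes_le_lebesgue_null (A : set (measurableTypeR R)) :
  mu A = 0%E -> lebesgue_stieltjes_measure g A = 0%E.
Proof.
move=> A0.
have L0 : 0 <= L.
  have := @g_lip 0 1 ler01; rewrite subr0 mulr1; apply: le_trans.
  by rewrite subr_ge0; apply: cumulative_is_nondecreasing.
have wl (B : set (ocitv_type R)) : measurable B ->
    (wlength g B <= L%:E * wlength idfun B)%E.
  case=> -[a b] _ <- /=; rewrite !wlength_itv/= lte_fin.
  by case: ifPn => [/ltW ab|]; rewrite ?mule0// -!EFinD -EFinM lee_fin g_lip.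
apply/eqP; rewrite eq_le; apply/andP; split; last exact: measure_ge0.
apply/lee_addgt0Pr => e e0; rewrite add0e.
have L10 : 0 < L + 1 by rewrite ltr_wpDl.
have : (mu A < (e / (L + 1))%:E)%E by rewrite A0 lte_fin divr_gt0.
move=> /ereal_inf_lt[_ [F [mF AF] <-] Fe].
apply: (@le_trans _ _ (\sum_(k <oo) wlength g (F k))%E).
  by apply: ereal_inf_lbound; exists F.
apply: (@le_trans _ _ (\sum_(k <oo) (L%:E * wlength idfun (F k)))%E).
  by apply: lee_nneseries => [k _ _|k _]; [exact: wlength_ge0|exact: wl].
rewrite nneseriesZl//.
apply: (@le_trans _ _ (L%:E * (e / (L + 1))%:E)%E).
  by apply: lee_wpmul2l; [rewrite lee_fin|exact: ltW].
rewrite -EFinM lee_fin mulrCA ger_pMr// ler_pdivrMr// mul1r.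
by rewrite lerDl.
Qed.

Lemma stieltjes_itv (a b : R) : a <= b ->
  lebesgue_stieltjes_measure g `]a, b] = (g b - g a)%:E.
Proof.
move=> ab.
have -> : lebesgue_stieltjes_measure g `]a, b] = wlength g `]a, b].
  by apply: measurable_mu_extE; exact: is_ocitv.
by rewrite wlength_itv_bnd.
Qed.

(** By the Radon-Nikodym theorem g is, up to a constant, an indefinite integral on
]-k, k]; Lebesgue's differentiation theorem concludes. *)
Lemma stieltjes_ae_derivable_bounded (k : R) : 0 < k ->
  {ae mu, forall t, - k < t < k -> derivable (g : R^o -> R^o) t 1}.
Proof.
move=> k0.
pose D : set (measurableTypeR R) := `]- k, k]%classic.
have mD : measurable D by exact: (measurable_itv `]- k, k]).
have Doo : (lebesgue_stieltjes_measure g D < +oo)%E.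
  by rewrite stieltjes_itv ?ltry// lerNl; lra.
pose nu : {finite_measure set (measurableTypeR R) -> \bar R} := mfrestr mD Doo.
have numu : nu `<< mu.
  apply/null_content_dominatesP => A mA A0.
  apply: stieltjes_le_lebesgue_null; apply/eqP; rewrite eq_le measure_ge0 andbT.
  rewrite -A0; apply: le_measure; rewrite ?inE//; exact: measurableI.
have [h [h0 hfin hint hE]] := radon_nikodym_sigma_finite numu.
pose f := fine \o h.
have fE : EFin \o f = h by apply/funext => x /=; rewrite fineK.
have fint : mu.-integrable setT (EFin \o f) by rewrite fE.
have intf y : mu.-integrable [set` Interval (BRight (- k)) (BRight y)] (EFin \o f).
  by apply: integrableS fint => //; exact: measurable_itv.
have locf : locally_integrable [set: R] f.
  by apply: open_integrable_locally => //; exact: openT.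
apply: ae_imply (FTC1 intf locf) _ => t Ht /andP[kt tk].
have kt' : (BRight (- k) < BRight t)%O by rewrite bnd_simp.
have [] := Ht kt'.
set F := (fun x => _) => dF _.
have FE x : - k <= x <= k -> F x = g x - g (- k).
  move=> /andP[kx xk]; rewrite /F /Rintegral.
  have := hE `]- k, x]%classic; rewrite -fE => <- //.
  rewrite /nu/= /mfrestr/= /mrestr/=.
  have -> : `]- k, x] `&` D = `]- k, x]%classic.
    apply/setIidPl => z /=; rewrite /D/= !in_itv/= => /andP[-> zx] /=.
    exact: le_trans xk.
  by rewrite stieltjes_itv.
have /near_eq_derivable : {near t, (fun x => F x + g (- k)) =1 g}.
  near=> x; rewrite FE ?subrK//; apply/andP; split; apply: ltW; near: x.
    exact: lt_nbhsr.
  exact: lt_nbhsl.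
by apply => //; apply: derivableD.
Unshelve. all: by end_near. Qed.

End stieltjes.
(** Clamping the variable to [a, b] makes f Lipschitz on the line, and adding
L * t makes it nondecreasing, so that it is a Stieltjes function. *)
Lemma lipschitz_ae_derivable (f : R -> R) (a b L : R) :
  (forall s t, a <= s -> s <= t -> t <= b -> `|f t - f s| <= L * (t - s)) ->
  {ae mu, forall t, a < t < b -> derivable (f : R^o -> R^o) t 1}.
Proof.
move=> flip.
have [ba|ab] := leP b a.
  apply: ae_true => t /andP[at_ tb].
  by have := lt_trans at_ tb; rewrite ltNge ba.
have L0 : 0 <= L.
  have := flip a b (lexx _) (ltW ab) (lexx _).
  by move/(le_trans (normr_ge0 _)); rewrite pmulr_lge0// subr_gt0.
pose c t := Num.max a (Num.min b t).
have ac t : a <= c t by rewrite le_max lexx.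
have cb t : c t <= b by rewrite ge_max ge_min lexx (ltW ab).
have cE t : a <= t <= b -> c t = t.
  by move=> /andP[at_ tb]; rewrite /c (min_idPr tb); exact/max_idPr.
have c_incr s t : s <= t -> 0 <= c t - c s <= t - s.
  have cP x : [\/ x <= a /\ c x = a, a <= x <= b /\ c x = x | b <= x /\ c x = b].
    have [xa|ax] := leP x a.
      apply: Or31; split=> //; apply/max_idPl; rewrite ge_min xa orbT//.
    have [xb|bx] := leP x b; first by apply: Or32; rewrite cE ltW.
    apply: Or33; rewrite ltW//; split=> //.
    by rewrite /c (min_idPl (ltW bx)); apply/max_idPr/ltW.
  by move=> st; case: (cP s) => -[? ->]; case: (cP t) => -[? ->]; lra.
pose g0 t := f (c t) + L * t.
have g_nd s t : s <= t -> 0 <= g0 t - g0 s <= (L + L) * (t - s).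
  move=> st; have /andP[c0 c1] := c_incr _ _ st.
  have := flip (c s) (c t) (ac _) _ (cb _); rewrite -subr_ge0 => /(_ c0).
  rewrite ler_norml => /andP[h1 h2].
  have : L * (c t - c s) <= L * (t - s) by exact: ler_wpM2l.
  by rewrite /g0; lra.
have g_mono : nondecreasing g0.
  by move=> s t /g_nd/andP[+ _]; rewrite subr_ge0.
have g_rc : forall x, g0 @ at_right x --> g0 x.
  apply: right_continuousW => x; apply/cvgrPdist_le => e e0.
  have LL0 : 0 < L + L + 1 by lra.
  near=> t.
  have xt : `|x - t| <= e / (L + L + 1).
    by near: t; apply: (@cvgr_dist_le _ R^o); [exact: cvg_id|rewrite divr_gt0].
  rewrite ler_pdivlMr// in xt.
  apply: le_trans xt.
  have := normr_ge0 (x - t).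
  have [/[dup] xt /g_nd gxt|/ltW/[dup] tx /g_nd gtx] := leP x t.
    rewrite !ler0_norm; lra.
  rewrite !ger0_norm; lra.
pose g : cumulative R R := HB.pack g0 (isCumulative.Build R _ R g0 g_mono g_rc).
have k0 : 0 < `|a| + `|b| + 1 by rewrite ltr_pwDr// addr_ge0.
have := @stieltjes_ae_derivable_bounded g (L + L) _ _ k0.
have g_lip x y : x <= y -> g y - g x <= (L + L) * (y - x) by move=> /g_nd/andP[].
move=> /(_ g_lip)/ae_imply; apply => t Ht /andP[at_ tb].
have {}Ht : derivable (g : R^o -> R^o) t 1.
  apply: Ht; have := ler_norm (- a); have := ler_norm b; rewrite normrN.
  have := normr_ge0 a; have := normr_ge0 b; lra.
have : derivable (fun x : R^o => g x - L *: x : R^o) t 1.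
  by apply: derivableB => //; apply: derivableZ.
apply: near_eq_derivable.
near=> x; have axb : a <= x <= b.
  by apply/andP; split; apply: ltW; near: x; [exact: lt_nbhsr|exact: lt_nbhsl].
by rewrite /= /g0 cE// addrK.
Unshelve. all: by end_near. Qed.

Lemma lipschitz_rV_ae_derivable (n : nat) (f : R -> 'rV[R]_n) (a b L : R) :
  (forall s t, a <= s -> s <= t -> t <= b -> `|f t - f s| <= L * (t - s)) ->
  {ae mu, forall t, a < t < b -> derivable (f : R^o -> 'rV[R]_n) t 1}.
Proof.
move=> flip.
have H (k : 'I_n) : {ae mu, forall t, a < t < b ->
    derivable (fun x => f x 0 k : R^o) (t : R^o) 1}.
  apply: (@lipschitz_ae_derivable _ _ _ L) => s t as_ st tb.
  apply: le_trans (flip s t as_ st tb).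
  have -> : f t 0 k - f s 0 k = (f t - f s) 0 k by rewrite !mxE.
  exact: coord_norm_le.
apply: ae_imply (ae_forall_fin H) _ => t Ht atb.
by apply/derivable_mxP => i j; rewrite ord1; exact: Ht.
Qed.

End lipschitz_derivable.

(** * Calculus of C1 maps *)

(** Differentials are local; this is what lets functions on the manifold be
compared with their expressions in charts. *)
Lemma near_is_diff (R : numFieldType) (V W : normedModType R) (f g df : V -> W)
    (x : V) :
  (\forall z \near x, f z = g z) -> is_diff x f df -> is_diff x g df.
Proof.
move=> fg [dfx <-].
have [cd /eqaddoP fo] := (diff_locallyP _ _).1 dfx.
have go : g \o shift x = cst (g x) + 'd f x +o_ 0 id.
  apply/eqaddoP => e e0; have := fo e e0.
  rewrite (nbhs_singleton fg).
  have : \forall h \near 0, f (h + x) = g (h + x).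
    have := fg; rewrite [in X in X -> _](near_shift 0) subr0.
    by apply: filterS => h; rewrite /= addrC.
  apply: filterS2 => h /= E; by rewrite /GRing.add/= E.
have E := diff_unique cd go.
by apply: DiffDef => //; apply/diff_locallyP; rewrite E.
Qed.

Section C1.
Variables (R : realType) (n : nat).
Local Notation V := 'rV[R]_n.

(** A pointwise form of [C1_on], stable under changes of the function away from
the point. *)
Definition C1at (W : normedModType R) (f : V -> W) (y : V) :=
  (\forall z \near y, differentiable f z) /\
  forall v, {for y, continuous (fun z => 'd f z v)}.

Lemma C1at_intro (W : normedModType R) (f : V -> W) (df : V -> V -> W) (y : V) :
  (\forall z \near y, is_diff z f (df z)) ->
  (forall v, {for y, continuous (fun z => df z v)}) -> C1at f y.
Proof.
move=> dfn cdf; split; first by apply: filterS dfn => z [].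
move=> v.
have E : \forall z \near y, df z v = 'd f z v.
  by apply: filterS dfn => z [_ ->].
have E0 : df y v = 'd f y v := nbhs_singleton E.
have := cdf v; rewrite /prop_for /continuous_at {}E0 => cdfv.
exact: cvg_trans (near_eq_cvg E) cdfv.
Qed.

Lemma C1at_diff (W : normedModType R) (f : V -> W) (y : V) :
  C1at f y -> differentiable f y.
Proof. by case=> /nbhs_singleton. Qed.

Lemma C1at_isdiff (W : normedModType R) (f : V -> W) (y : V) :
  C1at f y -> \forall z \near y, is_diff z f ('d f z).
Proof. by case=> + _; apply: filterS => z /differentiableP. Qed.

Lemma C1_onP (W : normedModType R) (O : set V) (f : V -> W) : open O ->
  C1_on O f <-> forall y, O y -> C1at f y.
Proof.
move=> oO; split=> [H y Oy|H y Oy]; last first.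
  by split; [exact: C1at_diff (H _ Oy)|case: (H _ Oy)].
split; last by case: (H _ Oy).
have : nbhs y O by exact: open_nbhs_nbhs.
by apply: filterS => z /H[].
Qed.

Lemma C1at_near (W : normedModType R) (f g : V -> W) (y : V) :
  (\forall z \near y, f z = g z) -> C1at f y -> C1at g y.
Proof.
move=> fg fC; apply: (@C1at_intro _ _ (fun z => 'd f z)); last by case: fC.
have := C1at_isdiff fC; have /near_join : \forall z \near y, f z = g z by [].
by apply: filterS2 => z zE; exact: near_is_diff.
Qed.

Lemma C1at_cst (W : normedModType R) (c : W) (y : V) : C1at (fun=> c) y.
Proof.
apply: (@C1at_intro _ _ (fun=> 0)) => [|v]; last exact: cst_continuous.
by near=> z; exact: is_diff_cst.
Unshelve. all: by end_near. Qed.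

Lemma C1at_coord (k : 'I_n) (y : V) : C1at (fun z => z 0 k : R^o) y.
Proof.
have lin : linear (fun z : V => z 0 k : R^o) by move=> a u v; rewrite !mxE.
pose f : {linear V -> R^o} := HB.pack (fun z : V => z 0 k : R^o)
  (GRing.isLinear.Build _ _ _ _ _ lin).
have cf : continuous f by exact: coord_continuous.
rewrite -[fun z => _]/(f : V -> R^o).
apply: (@C1at_intro _ _ (fun=> f)) => [|v]; last exact: cst_continuous.
near=> z; apply: DiffDef; first exact: linear_differentiable.
exact: diff_lin.
Unshelve. all: by end_near. Qed.

Lemma C1atD (W : normedModType R) (f g : V -> W) (y : V) :
  C1at f y -> C1at g y -> C1at (f + g) y.
Proof.
move=> fC gC; apply: (@C1at_intro _ _ (fun z => ('d f z : V -> W) + 'd g z)).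
  have := C1at_isdiff fC; have := C1at_isdiff gC.
  by apply: filterS2 => z gz fz; exact: is_diffD.
by move=> v; apply: continuousD; [case: fC|case: gC].
Qed.

Lemma C1atM (f g : V -> R^o) (y : V) :
  C1at f y -> C1at g y -> C1at (f * g : V -> R^o) y.
Proof.
move=> fC gC.
apply: (@C1at_intro _ _ (fun z => f z *: ('d g z : V -> R^o) + g z *: ('d f z : V -> R^o))).
  have := C1at_isdiff fC; have := C1at_isdiff gC.
  by apply: filterS2 => z gz fz; exact: is_diffM.
have cf := differentiable_continuous (C1at_diff fC).
have cg := differentiable_continuous (C1at_diff gC).
move=> v; apply: continuousD; apply: continuousM => //; by [case: fC|case: gC].
Qed.

Lemma C1at_comp_scalar (f : V -> R^o) (h dh : R -> R) (y : V) :
  (forall s, is_derive (s : R^o) 1 (h : R^o -> R^o) (dh s)) -> continuous dh ->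
  C1at f y -> C1at (h \o f : V -> R^o) y.
Proof.
move=> hD hc fC.
apply: (@C1at_intro _ _ (fun z v => 'd f z v * dh (f z))).
  have := C1at_isdiff fC; apply: filterS => z fz.
  have hz : is_diff (f z) (h : R^o -> R^o) (fun u => u *: (dh (f z) : R^o)).
    have [hd hv] := hD (f z); have /derivable1_diffP hdiff := hd.
    by apply: DiffDef => //; rewrite diff1E// derive1E hv.
  exact: is_diff_comp.
have cf := differentiable_continuous (C1at_diff fC).
move=> v; apply: continuousM; first by case: fC.
by apply: continuous_comp => //; exact: hc.
Qed.

End C1.

Lemma continuous_sum_at (R : numFieldType) (T : topologicalType)
    (W : normedModType R) (I : Type) (s : seq I) (F : I -> T -> W) (x : T) :
  (forall i, {for x, continuous (F i)}) ->
  {for x, continuous (fun z => \sum_(i <- s) F i z)}.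
Proof.
move=> cF; elim: s => [|i s ih].
  have -> : (fun z => \sum_(i <- [::]) F i z) = cst 0.
    by apply/funext => z; rewrite big_nil.
  exact: cst_continuous.
have -> : (fun z => \sum_(j <- i :: s) F j z) =
    F i \+ (fun z => \sum_(j <- s) F j z).
  by apply/funext => z; rewrite big_cons.
exact: continuousD.
Qed.

(** The differential of g is only known to depend continuously on the point for a
fixed vector, whereas here the vector moves as well; expanding it in the
canonical basis reduces to fixed vectors. *)
Lemma C1at_comp (R : realType) (m n : nat) (W : normedModType R)
    (f : 'rV[R]_m -> 'rV[R]_n) (g : 'rV[R]_n -> W) (y : 'rV[R]_m) :
  C1at f y -> C1at g (f y) -> C1at (g \o f) y.
Proof.
move=> fC gC.
have cf := differentiable_continuous (C1at_diff fC).
apply: (@C1at_intro _ _ _ _ (fun z v => 'd g (f z) ('d f z v))).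
  have fd := C1at_isdiff fC; have gd : \forall z \near y, is_diff (f z) g ('d g (f z)).
    exact: cf (C1at_isdiff gC).
  by apply: filterS2 fd gd => z fz gz; exact: is_diff_comp.
move=> v.
have -> : (fun z => 'd g (f z) ('d f z v)) =
    (fun z => \sum_k ('d f z v) 0 k *: 'd g (f z) (delta_mx 0 k)).
  apply/funext => z; rewrite {1}(row_sum_delta ('d f z v)) linear_sum.
  by apply: eq_bigr => k _; rewrite linearZ.
apply: continuous_sum_at => k; apply: continuousZ.
  apply: (continuous_comp (f := fun z => 'd f z v) (g := fun u : 'rV_n => u 0 k)).
    by case: fC.
  exact: coord_continuous.
apply: (continuous_comp (f := f) (g := fun u => 'd g u (delta_mx 0 k))) => //.
by case: gC.
Qed.

(** * Cutoff functions on a manifold *)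

Section bump.
Variable R : realType.

(** The simplest C1 function of a real variable vanishing exactly on a half-line;
bumps are composed from it. *)
Definition pos_sq (s : R) : R := Num.max 0 s ^+ 2.

Lemma is_derive_pos_sq (s : R) :
  is_derive (s : R^o) 1 (pos_sq : R^o -> R^o) (2 * Num.max 0 s).
Proof.
apply/is_deriveP => e e0; exists e => // t ts.
have maxP (x : R) : 0 <= x /\ Num.max 0 x = x \/ x <= 0 /\ Num.max 0 x = 0.
  have [x0|x0] := leP x 0; [right|left; split=> //; exact: ltW].
  by split=> //; apply/max_idPl.
apply: (@le_trans _ _ (`|t - s| * `|t - s|)); last exact: ler_wpM2r (ltW ts).
rewrite /pos_sq /GRing.scale/= -normrM ler_norml [ `|_ * _| ]ger0_norm; last first.
  by rewrite -expr2 sqr_ge0.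
have ss := sqr_ge0 s; have tt := sqr_ge0 t; have ts2 := sqr_ge0 (t - s).
rewrite !expr2 in ss tt ts2 *; apply/andP.
case: (maxP s) => -[s0 ->]; case: (maxP t) => -[t0 ->].
- by split; nra.
- have := mulr_ge0_le0 s0 t0; split; nra.
- have := mulr_le0_ge0 s0 t0; split; nra.
- by split; nra.
Qed.

Lemma continuous_dpos_sq : continuous (fun s : R => 2 * Num.max 0 s).
Proof.
move=> s; apply: cvgM; first exact: cvg_cst.
exact: continuous_max (cvg_cst _) cvg_id.
Qed.

Variable n : nat.

(** With q y the squared Euclidean distance to x divided by r ^ 2 and p := [pos_sq],
the function p (1 - q) is positive near x and vanishes for q >= 1; composing with
1 - p (1 - 4 .) flattens its top to the constant 1, reached as soon as
q <= 1 / 2. *)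
Lemma bump (x : 'rV[R]_n) (r : R) : 0 < r ->
  exists b : 'rV[R]_n -> R^o, [/\ forall y, C1at b y,
    \forall y \near x, b y = 1 & forall y, r <= `|y - x| -> b y = 0].
Proof.
move=> r0.
pose q (y : 'rV[R]_n) : R^o := r ^- 2 * \sum_k (y 0 k - x 0 k) ^+ 2.
have r20 : 0 < r ^- 2 by rewrite invr_gt0 exprn_gt0.
have qC y : C1at q y.
  have sC : forall s : seq 'I_n,
      C1at (fun y : 'rV[R]_n => \sum_(k <- s) (y 0 k - x 0 k) ^+ 2 : R^o) y.
    elim=> [|k s ih].
      apply: C1at_near (C1at_cst (0 : R^o) y).
      by apply: filterE => z; rewrite big_nil.
    have kC : C1at (fun z : 'rV[R]_n => z 0 k - x 0 k : R^o) y.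
      exact: C1atD (C1at_coord k y) (C1at_cst (- x 0 k : R^o) y).
    apply: C1at_near (C1atD (C1atM kC kC) ih).
    by apply: filterE => z; rewrite big_cons.
  exact: C1atM (C1at_cst (r ^- 2 : R^o) y) (sC _).
pose m (c : R) (f : 'rV[R]_n -> R^o) : 'rV[R]_n -> R^o := fun y => 1 + c * f y.
have mC c f y : C1at f y -> C1at (m c f) y.
  move=> fC; exact: C1atD (C1at_cst (1 : R^o) y) (C1atM (C1at_cst (c : R^o) y) fC).
have pC f y : C1at f y -> C1at (pos_sq \o f : 'rV[R]_n -> R^o) y.
  exact: C1at_comp_scalar is_derive_pos_sq continuous_dpos_sq.
exists (m (-1) (pos_sq \o m (-4) (pos_sq \o m (-1) q))); split.
- by move=> y; exact/mC/pC/mC/pC/mC/qC.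
- have qx : q x = 0.
    by rewrite /q big1 ?mulr0// => k _; rewrite subrr expr0n.
  have qc : {for x, continuous q} := differentiable_continuous (C1at_diff (qC x)).
  have qx2 : nbhs (q x) [set s : R | s < 1 / 2].
    by rewrite qx; apply: lt_nbhsl; rewrite divr_gt0.
  have xq : \forall y \near x, q y < 1 / 2 := qc _ qx2.
  apply: filterS xq => y qy; rewrite /m /pos_sq/=.
  have -> : Num.max 0 (1 + -1 * q y) = 1 - q y by rewrite mulN1r; apply/max_idPr; lra.
  have /max_idPl -> : 1 + -4 * (1 - q y) ^+ 2 <= 0 by nra.
  by rewrite expr0n mulr0 addr0.
- move=> y ry; have q1 : 1 <= q y.
    rewrite /q mulrC ler_pdivlMr ?exprn_gt0// mul1r.
    have [yx|yx] := eqVneq y x.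
      by move: ry; rewrite yx subrr normr0 leNgt r0.
    have : mx_norm (y - x) != 0.
      by apply: contra yx => /eqP/mx_norm_eq0/eqP; rewrite subr_eq0.
    move=> /mx_norm_neq0[[i k] /= E]; rewrite ord1 in E.
    have {}ry : r <= `|y 0 k - x 0 k|.
      by move: ry; rewrite [leRHS]E !mxE.
    apply: (@le_trans _ _ (`|y 0 k - x 0 k| ^+ 2)).
      by rewrite lerXn2r// nnegrE// ltW.
    rewrite real_normK ?num_real// (bigD1 k)//= lerDl.
    by apply: sumr_ge0 => j _; exact: sqr_ge0.
  rewrite /m /pos_sq/=.
  have /max_idPl -> : 1 + -1 * q y <= 0 by lra.
  rewrite expr0n mulr0 addr0; have /max_idPr -> : (0 : R) <= 1 by [].
  by rewrite expr1n mulN1r subrr.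
Qed.

End bump.

Section cutoff.
Variables (R : realType) (n : nat) (M : C1manifold R n).
Implicit Types (x y : M) (c : chart_index M).

Lemma chart_dom_nbhs c x : chart_dom c x -> nbhs x (chart_dom c).
Proof. by move=> cx; apply: open_nbhs_nbhs; split => //; exact: chart_dom_open. Qed.

Lemma chart_image_nbhs c x :
  chart_dom c x -> nbhs (chart c x) (chart c @` chart_dom c).
Proof.
move=> cx; apply: open_nbhs_nbhs; split; first exact: chart_image_open.
by exists x.
Qed.

Lemma chart_inv_nbhs c x W : chart_dom c x -> nbhs x W ->
  \forall z \near chart c x, [/\ chart_dom c (chart_inv c z), W (chart_inv c z) &
    chart c (chart_inv c z) = z].
Proof.
move=> cx xW.
have cvi : nbhs (chart_inv c (chart c x)) (chart_dom c `&` W).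
  by rewrite chartK//; apply: filterI => //; exact: chart_dom_nbhs.
have := chart_inv_continuous cx cvi.
apply: filterS2 (chart_image_nbhs cx) => z [u cu <-] /=.
by rewrite chartK// => -[].
Qed.

Lemma C1_on_at (W : normedModType R) (O : set 'rV[R]_n) (f : 'rV[R]_n -> W)
    (z : 'rV[R]_n) : nbhs z O -> C1_on O f -> C1at f z.
Proof.
move=> zO fC; split; last by case: (fC _ (nbhs_singleton zO)).
by apply: filterS zO => u /fC[].
Qed.

Lemma chart_change_C1at c d x : chart_dom c x -> chart_dom d x ->
  C1at (chart d \o chart_inv c) (chart c x).
Proof.
move=> cx dx; apply: C1_on_at _ (@chart_C1 _ _ M c d).
apply: filterS (chart_inv_nbhs cx (chart_dom_nbhs dx)) => z [cz dz E].
by exists (chart_inv c z).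
Qed.

Lemma C1_functionP (psi : M -> R) : C1_function psi <->
  forall c x, chart_dom c x -> C1at (psi \o chart_inv c : 'rV[R]_n -> R^o) (chart c x).
Proof.
split=> [H c x cx|H c]; first exact: C1_on_at (chart_image_nbhs cx) (H c).
apply/C1_onP; first exact: chart_image_open.
by move=> _ [x cx <-]; exact: H.
Qed.

(** A function read in a chart is multiplied by a bump and extended by 0. The
extension is C1 because the support of the bump is the image of a compact set,
hence closed in the manifold, which is Hausdorff. *)
Theorem cutoff c x W : chart_dom c x -> nbhs x W ->
  exists2 V, nbhs x V & V `<=` W `&` chart_dom c /\
   forall f : 'rV[R]_n -> R^o, (forall z, C1at f z) ->
     exists2 psi : M -> R, C1_function psi &
       (forall y, V y -> psi y = f (chart c y)) /\
       (forall y, ~ W y -> psi y = 0).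
Proof.
move=> cx xW.
have /nbhs_ballP[e /= e0 eW] := chart_inv_nbhs cx xW.
pose r := e / 2; have r0 : 0 < r by rewrite divr_gt0.
have rW z : `|z - chart c x| <= r -> [/\ chart_dom c (chart_inv c z),
    W (chart_inv c z) & chart c (chart_inv c z) = z].
  move=> zr; apply: eW; rewrite -ball_normE/= distrC; apply: le_lt_trans zr _.
  by rewrite /r ltr_pdivrMr// ltr_pMr// ltr1n.
pose B := [set z | `|z - chart c x| <= r].
have cB : compact B.
  have -> : B = closed_ball_ Num.norm (chart c x) r.
    by apply/seteqP; split=> z /=; rewrite /B/= distrC.
  apply: bounded_closed_compact; last exact: closed_closed_ball_.
  rewrite /bounded_set /bounded_near; near=> N => z; rewrite /closed_ball_ /= distrC => zr.
  have -> : z = (z - chart c x) + chart c x by rewrite subrK.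
  apply: le_trans (ler_normD _ _) _; apply: le_trans (lerD zr (lexx _)) _.
  by near: N; apply: nbhs_pinfty_ge; rewrite num_real.
have cS : closed (chart_inv c @` B).
  apply: compact_closed; first exact: mfd_hausdorff.
  apply: continuous_compact => //; apply: continuous_in_subspaceT => z.
  rewrite inE => /rW[cz _ E]; rewrite -E; exact: chart_inv_continuous.
have [b [bC b1 b0]] := bump (chart c x) r0.
exists [set y | [/\ chart_dom c y, W y & b (chart c y) = 1]].
  have := chart_continuous cx b1; rewrite nbhs_filterE => b1'.
  by apply: filterS3 (chart_dom_nbhs cx) xW b1' => y.
split=> [y []//|f fC].
pose psi y := if `[<chart_dom c y>] then b (chart c y) * f (chart c y) else 0.
have psi0 y : (chart_dom c y -> r <= `|chart c y - chart c x|) -> psi y = 0.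
  by rewrite /psi; case: asboolP => // cy /(_ cy)/b0 ->; rewrite mul0r.
exists psi; last first.
  split=> [y [cy Wy by1]|y nWy].
    by rewrite /psi asboolT// by1 mul1r.
  apply: psi0 => cy; rewrite leNgt; apply/negP => /ltW/rW[_].
  by rewrite chartK.
apply/C1_functionP => d y dy.
have [cy|ncy] := pselect (chart_dom c y).
  have bfC : C1at (b * f : 'rV[R]_n -> R^o) ((chart c \o chart_inv d) (chart d y)).
    exact: C1atM.
  apply: C1at_near (C1at_comp (chart_change_C1at dy cy) bfC).
  apply: filterS (chart_inv_nbhs dy (chart_dom_nbhs cy)) => z [_ cz _].
  by rewrite /= /psi asboolT.
have yS : nbhs y (~` (chart_inv c @` B)).
  apply: open_nbhs_nbhs; split; first exact: closed_openC.
  by move=> [z /rW[+ _ _] E]; rewrite E.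
apply: C1at_near (C1at_cst (0 : R^o) _).
apply: filterS (chart_inv_nbhs dy yS) => z [_ nz _] /=.
rewrite psi0// => cz; rewrite leNgt; apply/negP => /ltW zr.
by apply: nz; exists (chart c (chart_inv d z)) => //; rewrite chartK.
Unshelve. all: by end_near. Qed.

End cutoff.

(** * C1 functions determine the topology *)

Lemma countable_nbhs_base (T : topologicalType) (x : T) :
  @second_countable T -> exists V : nat -> set T,
    (forall k, nbhs x (V k)) /\
    (forall U, nbhs x U -> exists k, forall l, (k <= l)%N -> V l `<=` U).
Proof.
move=> [B /countable_injP[i iinj] [Bo Bx]].
pose e k := xget setT [set U | B U /\ i U = k].
pose V k := [set y | forall l, (l <= k)%N -> nbhs x (e l) -> e l y].
exists V; split.
  elim=> [|k ih].
    have [xe|nxe] := pselect (nbhs x (e 0%N)).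
      by apply: filterS xe => y ey l; rewrite leqn0 => /eqP ->.
    by apply: filterE => y l; rewrite leqn0 => /eqP ->.
  have [xe|nxe] := pselect (nbhs x (e k.+1)).
    apply: filterS2 ih xe => y Vy ey l; rewrite leq_eqVlt => /orP[/eqP -> //|].
    by rewrite ltnS; exact: Vy.
  by apply: filterS ih => y Vy l; rewrite leq_eqVlt ltnS => /orP[/eqP -> //|/Vy].
move=> U /Bx[W /= [BW Wx] WU]; exists (i W) => l il y /(_ (i W) il).
have -> : e (i W) = W.
  rewrite /e; case: xgetP => [W' -> [BW' E]|/(_ W)[]//].
  by apply: iinj; rewrite ?inE.
move=> H; apply/WU/H; apply: open_nbhs_nbhs; split=> //; exact: Bo.
Qed.

Section C1_functions.
Variables (R : realType) (n : nat) (M : C1manifold R n).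
Implicit Types (x y : M) (c : chart_index M).

Lemma bump_function x W : nbhs x W ->
  exists2 beta : M -> R, C1_function beta &
    (\forall y \near x, beta y = 1) /\ (forall y, ~ W y -> beta y = 0).
Proof.
have [c cx] := chart_cover x; move=> xW.
have [V xV [_ /(_ (fun=> 1))[z|psi psiC [psi1 psi0]]]] := cutoff cx xW.
  exact: C1at_cst.
by exists psi => //; split=> //; apply: filterS xV.
Qed.

Lemma C1_function_continuous (psi : M -> R) : C1_function psi -> continuous psi.
Proof.
move=> /C1_functionP psiC x; have [c cx] := chart_cover x.
have h : {for x, continuous ((psi \o chart_inv c) \o chart c)}.
  apply: continuous_comp; first exact: chart_continuous.
  exact: differentiable_continuous (C1at_diff (psiC _ _ cx)).
have E : \forall y \near x, ((psi \o chart_inv c) \o chart c) y = psi y.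
  by apply: filterS (chart_dom_nbhs cx) => y cy /=; rewrite chartK.
rewrite /continuous_at -[X in _ --> X](nbhs_singleton E).
exact: cvg_trans (near_eq_cvg E) h.
Qed.

(** Testing against bump functions suffices. *)
Lemma C1_functions_cvg (T : Type) (F : set_system T) (g : T -> M) x :
  Filter F ->
  (forall psi : M -> R, C1_function psi -> psi (g t) @[t --> F] --> psi x) ->
  g t @[t --> F] --> x.
Proof.
move=> FF H W xW; have [beta betaC [b1 b0]] := bump_function xW.
have := H _ betaC; rewrite (nbhs_singleton b1) => /cvgrPdist_lt/(_ 1 ltr01).
rewrite /nbhs/=; apply: filterS => t bt; apply: contrapT => /b0 E.
by move: bt; rewrite E subr0 normr1 ltxx.
Qed.

Lemma C1_functions_separate x y :
  (forall psi : M -> R, C1_function psi -> psi x = psi y) -> x = y.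
Proof.
move=> H; have h : (fun _ : unit => x) @ (globally [set tt]) --> y.
  by apply: C1_functions_cvg => psi psiC; rewrite (H _ psiC); exact: cvg_cst.
apply: (mfd_hausdorff (c := M)) => A B /nbhs_singleton Ax /h Bx.
by exists x; split => //; exact: (Bx tt).
Qed.

End C1_functions.

(** * The flow map read in a chart *)

Lemma infinite_natP (A : set nat) :
  infinite_set A <-> forall N, exists2 i, (N <= i)%N & A i.
Proof.
split=> [infA N|H /finite_seqP[s sA]].
  apply: contrapT => nN; apply: infA; apply: (@sub_finite_set _ _ `I_N) => //.
  move=> i Ai /=; rewrite ltnNge; apply/negP => Ni; apply: nN; by exists i.
have [i si Ai] := H (\max_(i <- s) i).+1.
have : i \in s by move: Ai; rewrite sA.
by move=> is_; have := @leq_bigmax_seq _ s xpredT id i is_ isT; rewrite leqNgt si.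
Qed.

Section flow_map.
Variables (R : realType) (n : nat) (M : C1manifold R n).

(** The components in a chart are continuous where the chart is defined. *)
Lemma tangent_comp_nbhs c (w : tangent_bundle M) (e : R) :
  chart_dom c (tangent_base w) -> 0 < e ->
  \forall w' \near w, chart_dom c (tangent_base w') /\
    `|tangent_comp w' c - tangent_comp w c| < e.
Proof.
move=> cw e0.
pose O : set ('rV[R]_n * 'rV[R]_n) := [set p | `|p.2 - tangent_comp w c| < e].
have oO : open O.
  have -> : O = snd @^-1` (ball (tangent_comp w c) e).
    by apply/seteqP; split=> p; rewrite /O /= -ball_normE/= distrC.
  by apply: open_comp; [move=> p _; exact: cvg_snd|exact: ball_open].
have oW : open (bundle_chart_preimage c O).
  exists [set bundle_chart_preimage c O]; last by rewrite bigcup_set1.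
  move=> _ ->; exists (fset1 (bundle_chart_preimage c O)) => /=.
    by move=> W /fset1P ->; apply/mem_set; exists c, O.
  apply/seteqP; split=> z /=; last by move=> Oz W /fset1P ->.
  by move=> Wz; apply: Wz => /=; exact/fset1P.
apply: filterS (open_nbhs_nbhs (conj oW _)) => [w' []|]//.
by split=> //; rewrite /O/= subrr normr0.
Qed.

Variable H : hybrid_system M.
Hypothesis HH : hybrid_basic_conditions H.
Notation FC := (set_valued_restrict (flow_set H) (flow_map H)).

Lemma flow_base x w : FC x w -> tangent_base w = x.
Proof. by case=> _ /flow_map_tangent. Qed.

(** If the conclusion failed along points y_k converging to x, velocities w_k
violating it would stay in a compact set by local precompactness, and a cluster
point of them would lie in F(x) by outer semicontinuity: a contradiction. *)
Theorem flow_map_usc c (x : M) (e : R) : chart_dom c x -> 0 < e ->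
  \forall y \near x, forall w, FC y w ->
    exists2 w0, FC x w0 & `|tangent_comp w c - tangent_comp w0 c| < e.
Proof.
move=> cx e0; apply: contrapT => nH.
have [V [Vx Vbase]] := countable_nbhs_base x (@mfd_second_countable _ _ M).
have /choice[u uP] : forall k, exists p : M * tangent_bundle M,
    [/\ V k p.1, FC p.1 p.2 &
     forall w0, FC x w0 -> e <= `|tangent_comp p.2 c - tangent_comp w0 c|].
  move=> k; apply: contrapT => nk; apply: nH.
  apply: filterS (Vx k) => y Vy w Fw; apply: contrapT => nw; apply: nk.
  exists (y, w); split=> // w0 Fw0; rewrite leNgt; apply/negP => ww0.
  by apply: nw; exists w0.
have ux : (fun k => (u k).1) @ \oo --> x.
  move=> U /Vbase[k kU]; exists k => // l /= kl.
  by apply: (kU l kl); case: (uP l).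
have [V0 xV0 [K V0K [cK _]]] := flow_map_precompact HH x.
have [w [Kw clw]] : K `&` cluster ((fun k => (u k).2) @ \oo) !=set0.
  apply: cK; have uV0 : \forall k \near \oo, V0 (u k).1 := ux _ xV0.
  suff : \forall k \near \oo, K (u k).2 by [].
  apply: filterS uV0 => k Vk.
  by apply: V0K; exists (u k).1 => //; case: (uP k).
have inf U : nbhs w U -> forall N, exists2 k, (N <= k)%N & U (u k).2.
  move=> wU N; have [] := clw ((fun k => (u k).2) @` [set k | (N <= k)%N]) U.
  - by exists N => // k /= Nk; exists k.
  - exact: wU.
  - by move=> _ [[k /= Nk <-] Uk]; exists k.
have Fw : FC x w.
  apply: (flow_map_osc HH ux) => U wU; apply/infinite_natP => N.
  have [k Nk Uk] := inf U wU N; exists k => //.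
  by exists (u k).2; split=> //; case: (uP k).
have cw : chart_dom c (tangent_base w) by rewrite (flow_base Fw).
have [k _ [_]] := inf _ (tangent_comp_nbhs cw e0) 0%N.
by rewrite ltNge; case: (uP k) => _ _ ->.
Qed.

(** The values are closed, by outer semicontinuity along a constant sequence. *)
Lemma flow_map_compact c (x : M) : chart_dom c x ->
  compact ((fun w : tangent_bundle M => tangent_comp w c) @` FC x).
Proof.
move=> cx; apply: continuous_compact.
  apply: continuous_in_subspaceT => w; rewrite inE => Fw.
  suff cvw : tangent_comp w' c @[w' --> w] --> tangent_comp w c by exact: cvw.
  have FF : Filter (nbhs w) := nbhs_filter w.
  apply/(cvgrPdist_lt (FF := FF)) => e e0.
  have cw : chart_dom c (tangent_base w) by rewrite (flow_base Fw).
  have we : \forall w' \near w, `|tangent_comp w c - tangent_comp w' c| < e.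
    by apply: filterS (tangent_comp_nbhs cw e0) => w' []; rewrite distrC.
  exact: we.
have [V0 xV0 [K V0K [cK _]]] := flow_map_precompact HH x.
apply: (subclosed_compact _ cK).
  rewrite closedE => w clw; apply: (flow_map_osc HH (@cvg_cst _ x _ _ _)).
  move=> U wU; apply/infinite_natP => N; exists N => //=.
  apply: contrapT => nU; apply: clw; apply: filterS wU => w' Uw' Fw'.
  by apply: nU; exists w'.
by move=> w Fw; apply: V0K; exists x => //; exact: nbhs_singleton.
Qed.

Lemma flow_map_convex_comp c (x : M) :
  convex_in ((fun w : tangent_bundle M => tangent_comp w c) @` FC x).
Proof.
move=> s t _ _ s0 t0 st [w1 [Cx Fw1] <-] [w2 [_ Fw2] <-].
have := flow_map_convex HH Cx; rewrite /tangent_convex.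
have s01 : 0 <= s <= 1 by rewrite s0 -st lerDl.
move=> /(_ (@tangent_comp _ _ _ w1) (@tangent_comp _ _ _ w2)).
move=> /(_ (Itv01 s0 (andP s01).2)); rewrite !inE => /(_ _ _)[].
- by exists w1.
- by exists w2.
move=> w Fw E; exists w => //=; rewrite E/=.
rewrite -[LHS]/(s *: tangent_comp w1 c + (1 - s) *: tangent_comp w2 c).
by rewrite -st [s + t]addrC addrK.
Qed.

Lemma flow_map_bounded c (x : M) : chart_dom c x ->
  exists B, \forall y \near x, forall w, FC y w -> `|tangent_comp w c| <= B.
Proof.
move=> cx.
have [B [_ /(_ (B + 1))]] := compact_bounded (flow_map_compact cx).
rewrite ltrDl ltr01 => /(_ isT) Bb.
exists (B + 1 + 1); apply: filterS (flow_map_usc cx ltr01) => y yF w /yF[w0 Fw0 ww0].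
have -> : tangent_comp w c = tangent_comp w0 c + (tangent_comp w c - tangent_comp w0 c).
  by rewrite addrC subrK.
apply: le_trans (ler_normD _ _) _; apply: lerD; last exact: ltW.
by apply: Bb; exists w0.
Qed.

End flow_map.

(** * Hybrid time domains and their jump times *)

Section time_domains.
Variable R : realType.
Implicit Types (E : set (R * nat)) (T : nat -> \bar R).

(** A complete hybrid time domain is described by the times T j at which the j-th
flow interval begins; after the last jump these are +oo, and the last interval
is then a half-line. *)
Definition jump_times T :=
  T 0%N = 0%E /\ forall j, (T j <= T j.+1)%E.

Definition jump_domain T : set (R * nat) :=
  [set p | (T p.2 <= p.1%:E)%E /\ (p.1%:E <= T p.2.+1)%E].

Definition unbounded_domain E :=
  forall N : R, exists2 p, E p & N < p.1 + p.2%:R.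

Lemma compact_domain_mono (J : nat) (t : nat -> R) :
  (forall j, (j <= J)%N -> t j <= t j.+1) ->
  forall i j, (i <= j)%N -> (j <= J.+1)%N -> t i <= t j.
Proof.
move=> tJ i; elim=> [|j ih]; first by rewrite leqn0 => /eqP ->.
rewrite leq_eqVlt => /orP[/eqP -> //|]; rewrite ltnS => ij jJ.
by apply: le_trans (tJ j jJ); apply: ih => //; exact: ltnW.
Qed.

Section hybrid_domain.
Variable E : set (R * nat).
Hypothesis htdE : hybrid_time_domain E.

Lemma domain_origin : E (0, 0%N).
Proof.
have [Es [cEs _ ->]] := htdE; exists 0%N => //.
have [J [t [t0 tJ ->]]] := cEs 0%N; split=> //=.
by rewrite t0 lexx -t0 tJ.
Qed.

Lemma domain_order t j t' j' : E (t, j) -> E (t', j') -> (j < j')%N -> t <= t'.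
Proof.
have [Es [cEs incEs ->]] := htdE => -[k _ kt] [l _ lt'] jj'.
have sub a b : (a <= b)%N -> Es a `<=` Es b.
  elim: b => [|b ih]; first by rewrite leqn0 => /eqP ->.
  rewrite leq_eqVlt => /orP[/eqP -> //|ab]; apply: subset_trans (incEs b).
  exact: ih.
have {}kt := sub _ _ (leq_maxl k l) _ kt.
have {}lt' := sub _ _ (leq_maxr k l) _ lt'.
have [J [s [_ sJ EE]]] := cEs (maxn k l); rewrite EE in kt lt'.
case: kt lt' => /= jJ /andP[_ tj] [/= j'J /andP[tj' _]].
apply: (le_trans tj); apply: le_trans tj'.
by apply: (compact_domain_mono sJ) => //; exact: ltnW.
Qed.

Lemma domain_slice_start t j : E (t, j) -> exists a,
  [/\ a <= t, forall u, a <= u <= t -> E (u, j) &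
      (j = 0%N /\ a = 0) \/ (exists2 i, j = i.+1 & E (a, i))].
Proof.
have [Es [cEs incEs EE]] := htdE; rewrite EE => -[k _].
have [J [s [s0 sJ EsE]]] := cEs k; rewrite EsE => -[/= jJ /andP[st ts]].
exists (s j); split=> //.
  move=> u /andP[su ut]; exists k => //; rewrite EsE; split=> //=.
  by rewrite su (le_trans ut ts).
case: j jJ {st ts} => [|i] iJ; [left=> //|right].
exists i => //; exists k => //; rewrite EsE; split; first exact: ltnW.
by rewrite /= lexx sJ// ltnW.
Qed.

Lemma domain_ge0 t j : E (t, j) -> 0 <= t.
Proof.
move=> Et; case: j Et => [|j] Et; last exact: domain_order domain_origin Et _.
by have [a [at_ _ [[_ <-]//|[i]]]] := domain_slice_start Et.
Qed.

Lemma domain_down t j i : E (t, j) -> (i <= j)%N -> exists s, E (s, i).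
Proof.
elim: j t => [|j ih] t Et; first by rewrite leqn0 => /eqP ->; exists t.
rewrite leq_eqVlt => /orP[/eqP ->|]; first by exists t.
have [a [_ _ [[]//|[k [<-] Ek]]]] := domain_slice_start Et.
by rewrite ltnS; exact: ih Ek.
Qed.

(** A nonempty flow interval contains its left endpoint, which is also the last
time of the preceding one. *)
Lemma domain_slice_min t j : E (t, j) -> exists a,
  [/\ E (a, j), forall u, E (u, j) -> a <= u, forall u, a <= u <= t -> E (u, j) &
   forall i, j = i.+1 -> E (a, i)].
Proof.
move=> Et; have [a [at_ Ea aj]] := domain_slice_start Et.
exists a; split=> //; first by apply: Ea; rewrite lexx.
- move=> u Eu; case: aj => [[j0 ->]|[i ij Eai]]; first exact: domain_ge0 Eu.
  by apply: domain_order Eai Eu _; rewrite ij.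
- by move=> i ij; case: aj => [[]|[i' ij' Ei']]; [rewrite ij|move: Ei'; rewrite ij in ij'; case: ij' => <-].
Qed.

Lemma domain_convex s t u j : E (s, j) -> E (t, j) -> s <= u <= t -> E (u, j).
Proof.
move=> Es Et /andP[su ut]; have [a [_ amin aE _]] := domain_slice_min Et.
by apply: aE; rewrite ut (le_trans (amin _ Es)).
Qed.

Theorem domain_jump_times : unbounded_domain E ->
  exists2 T, jump_times T & E = jump_domain T.
Proof.
move=> unbE.
pose T j := ereal_inf [set t%:E | t in [set t | E (t, j)]].
have c1 t j : E (t, j) -> (T j <= t%:E)%E.
  by move=> Et; apply: ereal_inf_lbound; exists t.
have TE t j : E (t, j) -> (forall u, E (u, j) -> t <= u) -> T j = t%:E.
  move=> Et tmin; apply/eqP; rewrite eq_le c1//=.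
  by apply: le_ereal_inf_tmp => _ [u Eu <-]; rewrite lee_fin; exact: tmin.
exists T.
  split.
    by apply: (TE 0 0%N); [exact: domain_origin|move=> u /domain_ge0].
  move=> j; apply: le_ereal_inf_tmp => _ [u Eu <-].
  have [a [Ea amin _ /(_ _ erefl) Eaj]] := domain_slice_min Eu.
  by apply: (le_trans (c1 _ _ Eaj)); rewrite lee_fin; exact: amin.
apply/seteqP; split=> [[t j] Et|[t j]].
  split; first exact: c1.
  apply: le_ereal_inf_tmp => _ [u Eu <-]; rewrite lee_fin.
  exact: domain_order Et Eu _.
rewrite /jump_domain /= => -[Tt tT].
have [s Es] : exists s, E (s, j).
  apply: contrapT => nE; move: Tt; rewrite /T.
  have -> : [set t%:E | t in [set t | E (t, j)]] = set0 :> set (\bar R).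
    by apply/seteqP; split=> // x [u Eu _]; apply: nE; exists u.
  by rewrite ereal_inf0.
have [a [Ea amin aE _]] := domain_slice_min Es.
have at_ : a <= t by rewrite -lee_fin -(TE _ _ Ea amin).
suff [s' ts' Es'] : exists2 s', t <= s' & E (s', j).
  by apply: domain_convex Ea Es' _; rewrite at_.
have [ts|st] := leP t s; first by exists s.
have [[s' j'] /= Es' s't] := unbE (t + j%:R).
have [jj'|jj'|jj'] := ltngtP j j'.
- have [u Eu] := domain_down Es' jj'.
  have [b [Eb bmin _ /(_ _ erefl) Ebj]] := domain_slice_min Eu.
  by exists b => //; rewrite -lee_fin -(TE _ _ Eb bmin).
- have := domain_order Es' Es jj'.
  move=> s's; move: s't; rewrite ltNge => /negP[]; apply: lerD.
    exact: le_trans s's (ltW st).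
  by rewrite ler_nat ltnW.
- by exists s'; [move: s't; rewrite -jj' ltrD2r => /ltW|rewrite jj'].
Qed.

End hybrid_domain.

Section jump_domain.
Variable T : nat -> \bar R.
Hypothesis jT : jump_times T.

Lemma jump_times_mono i j : (i <= j)%N -> (T i <= T j)%E.
Proof.
elim: j => [|j ih]; first by rewrite leqn0 => /eqP ->.
rewrite leq_eqVlt => /orP[/eqP -> //|]; rewrite ltnS => /ih.
by move/le_trans; apply; exact: jT.2.
Qed.

Lemma jump_times_ge0 j : (0 <= T j)%E.
Proof. by rewrite -jT.1 jump_times_mono. Qed.

Lemma jump_times_cases :
  (forall j, T j \is a fin_num) \/
  exists J, (forall j, (j <= J)%N -> T j \is a fin_num) /\ T J.+1 = +oo%E.
Proof.
have [fT|/existsNP[j /negP nfT]] := pselect (forall j, T j \is a fin_num).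
  by left.
right; have ex : exists j, T j \isn't a fin_num by exists j.
case: (ex_minnP ex) => -[|J] nJ minJ; first by move: nJ; rewrite jT.1.
exists J; split.
  by move=> i iJ; apply: contraT => /minJ; rewrite ltnNge iJ.
move: nJ; rewrite fin_numE negb_and !negbK => /orP[/eqP E|/eqP ->//].
by have := jump_times_ge0 J.+1; rewrite E.
Qed.

Lemma jump_domain_hybrid : hybrid_time_domain (jump_domain T).
Proof.
have t0 : fine (T 0%N) = 0 by rewrite jT.1.
have fin_mono i j : (i <= j)%N -> T i \is a fin_num -> T j \is a fin_num ->
    fine (T i) <= fine (T j).
  by move=> ij Ti Tj; apply: fine_le => //; exact: jump_times_mono.
have [fT|[J [fT TJ]]] := jump_times_cases.
  exists (fun k => [set p | (p.2 <= k)%N /\ fine (T p.2) <= p.1 <= fine (T p.2.+1)]).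
  split=> [k|k [t j] /= [jk tj]|].
  - by exists k, (fine \o T); split=> //= j _; exact: fin_mono.
  - by split=> //; exact: leqW.
  - apply/seteqP; split=> [[t j] [/= Tt tT]|[t j] [k _ [/= jk /andP[Tt tT]]]].
      by exists j => //; split=> //=; rewrite -!lee_fin !fineK// Tt.
    by split; rewrite /= -[T _]fineK// lee_fin.
exists (fun k => [set p | (p.2 <= J)%N /\ fine (T p.2) <= p.1 <=
  (if (p.2 < J)%N then fine (T p.2.+1) else fine (T J) + k%:R)]).
split=> [k|k [t j] /= [jk /andP[Tt tT]]|].
- exists J, (fun j => if (j <= J)%N then fine (T j) else fine (T J) + k%:R).
  split=> [|j jJ|].
    - by rewrite /= t0.
    - rewrite jJ; case: ltnP => jJ'; first by apply: fin_mono => //; exact: fT.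
    have -> : j = J by apply/eqP; rewrite eqn_leq jJ.
    by rewrite lerDl.
    - by apply/seteqP; split=> -[t i] [/= iJ]; rewrite iJ.
- split=> //; rewrite Tt (le_trans tT)//; case: ifP => // _.
  by rewrite lerD2l ler_nat.
apply/seteqP; split=> [[t j] [/= Tt tT]|[t j] [k _ [/= jJ /andP[Tt tT]]]].
  have [jJ|Jj] := leqP j J; last first.
    by move: Tt; rewrite leNgt (lt_le_trans (ltry _))// -TJ jump_times_mono.
  exists (Num.truncn `|t - fine (T J)|).+1 => //; split=> //=.
  rewrite -lee_fin fineK ?fT// Tt/=; case: ifP => jJ'.
    by rewrite -lee_fin fineK ?fT.
  rewrite -lerBlDl (le_trans (ler_norm _))//.
  by apply: ltW; exact: Num.Theory.truncnS_gt.
split; rewrite /=; first by rewrite -[T j]fineK ?fT// lee_fin.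
have [jJ'|Jj] := ltnP j J.
  by move: tT; rewrite jJ' -[T j.+1]fineK ?fT// lee_fin.
have -> : j = J by apply/eqP; rewrite eqn_leq jJ.
by rewrite TJ leey.
Qed.

Lemma jump_domain_unbounded : unbounded_domain (jump_domain T).
Proof.
move=> N; have [fT|[J [fT TJ]]] := jump_times_cases.
  pose j := (Num.truncn `|N|).+1.
  exists (fine (T j), j).
    by split; rewrite /= fineK//; exact: jT.2.
  rewrite /= ltr_wpDl//.
    by apply: fine_ge0; exact: jump_times_ge0.
  exact: le_lt_trans (ler_norm _) (Num.Theory.truncnS_gt _).
exists (Num.max (fine (T J)) (N + 1), J).
  by split; rewrite /= ?TJ ?leey// -[leLHS]fineK ?fT// lee_fin le_max lexx.
rewrite /= (@lt_le_trans _ _ (N + 1)) ?ltrDl// ler_wpDr ?ler0n// le_max lexx orbT//.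
Qed.

End jump_domain.
End time_domains.

(** * Complete solutions are maximal *)

(** The jump times of an unbounded domain E are forced upon every larger domain,
since hybrid time is linearly ordered and E already leaves no room at its end. *)
Lemma unbounded_domain_max (R : realType) (E E' : set (R * nat)) :
  hybrid_time_domain E -> unbounded_domain E -> hybrid_time_domain E' ->
  E `<=` E' -> E' `<=` E.
Proof.
move=> hE uE hE' EE' [s j] Es.
have [T jT ET] := domain_jump_times hE uE.
have inE t i : (T i <= t%:E)%E -> (t%:E <= T i.+1)%E -> E' (t, i).
  by move=> Tt tT; apply: EE'; rewrite ET.
have s0 := domain_ge0 hE' Es.
rewrite ET; split=> /=; last first.
  have [fT|] := boolP (T j.+1 \is a fin_num).
    rewrite -(fineK fT) lee_fin; apply: (domain_order hE' Es (inE _ j.+1 _ _) _) => //.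
      by rewrite fineK.
    by rewrite fineK// (jT.2 j.+1).
  rewrite fin_numE negb_and !negbK => /orP[/eqP TE|/eqP ->]; last by rewrite leey.
  by have := jump_times_ge0 jT j.+1; rewrite TE.
have [fT|] := boolP (T j \is a fin_num).
  case: j Es fT => [|i] Es fT; first by rewrite jT.1 lee_fin.
  rewrite -(fineK fT) lee_fin; apply: (domain_order hE' (inE _ i _ _) Es _) => //.
    by rewrite fineK// jT.2.
  by rewrite fineK.
rewrite fin_numE negb_and !negbK => /orP[/eqP TE|/eqP TE].
  by have := jump_times_ge0 jT j; rewrite TE.
have [[t i] Et st] := uE (s + j%:R).
have ij : (i < j)%N.
  rewrite ltnNge; apply/negP => ji; move: Et; rewrite ET => -[/= Tt _].
  have := le_trans (jump_times_mono jT ji) Tt.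
  by rewrite TE leNgt ltry.
have ts := domain_order hE' (EE' _ Et) Es ij.
by move: st; rewrite ltNge => /negP[]; apply: lerD => //; rewrite ler_nat ltnW.
Qed.

Section complete.
Variables (R : realType) (n : nat) (M : C1manifold R n).
Implicit Type phi : partial_arc M.

Lemma complete_unbounded phi : hybrid_time_domain (arc_dom phi) ->
  complete_arc phi <-> unbounded_domain (arc_dom phi).
Proof.
move=> hE; rewrite /complete_arc.
set A := [set p.1%:E | p in arc_dom phi]; set B := [set p.2%:R%:E | p in arc_dom phi].
have ub (X : set (\bar R)) (N : R) : ereal_sup X = +oo%E -> exists2 x, X x & (N%:E < x)%E.
  move=> XE; apply/ereal_sup_gt; rewrite XE; exact: ltry.
split=> [E N|uE].
  have : ereal_sup A = +oo%E \/ ereal_sup B = +oo%E.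
    by move: E; case: (ereal_sup A) => [a| |]; case: (ereal_sup B) => [b| |] //; auto.
  case=> /ub -/(_ N)[_ [[t j] Et <-] /=]; rewrite lte_fin => Nt; exists (t, j) => //.
    by rewrite /= ltr_wpDr.
  by rewrite /= ltr_wpDl//; exact: domain_ge0 hE _ _ Et.
have A0 : (0 <= ereal_sup A)%E.
  by apply: ereal_sup_ubound; exists (0, 0%N) => //; exact: domain_origin.
have B0 : (0 <= ereal_sup B)%E.
  by apply: ereal_sup_ubound; exists (0, 0%N) => //; exact: domain_origin.
case AE : (ereal_sup A) A0 => [a| |] // _; last by rewrite addye// gt_eqF// (lt_le_trans _ B0).
case BE : (ereal_sup B) B0 => [b| |] // _.
have [[t j] Et] := uE (a + b).
rewrite ltNge => /negP[]; apply: lerD; rewrite -lee_fin.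
  by rewrite -AE; apply: ereal_sup_ubound; exists (t, j).
by rewrite -BE; apply: ereal_sup_ubound; exists (t, j).
Qed.

Lemma complete_solution_maximal (H : hybrid_system M) phi :
  solution H phi -> complete_arc phi -> maximal_solution H phi.
Proof.
move=> solphi cphi; split=> // -[psi [solpsi [sub nsub] _]]; apply: nsub.
have hphi := (solution_arc solphi).1; have hpsi := (solution_arc solpsi).1.
by apply: unbounded_domain_max => //; apply/complete_unbounded.
Qed.

End complete.

(** * Solutions are uniformly Lipschitz against C1 functions *)

Lemma abs_continuous_on_cont (R : realType) (a b : R) (f : R -> R) (t : R) :
  abs_continuous_on a b f -> a < t < b -> f s @[s --> t] --> f t.
Proof.
move=> fac /andP[at_ tb]; apply/cvgrPdist_lt => e e0.
have [d d0 dP] := fac _ e0.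
have inc u v : a <= u -> u <= v -> v <= b -> v - u < d -> `|f v - f u| < e.
  move=> au uv vb uvd.
  have := dP 1%N (fun=> u) (fun=> v); rewrite !big_ord1; apply=> //.
  by move=> k l; rewrite !ord1.
near=> s.
have as_ : a <= s by apply: ltW; near: s; exact: lt_nbhsr.
have sb : s <= b by apply: ltW; near: s; exact: lt_nbhsl.
have : `|t - s| < d by near: s; apply: (@cvgr_dist_lt _ R^o); [exact: cvg_id|].
have [st|/ltW ts] := leP s t.
  by rewrite ger0_norm ?subr_ge0// => h; apply: inc => //; exact: ltW.
by rewrite ler0_norm ?subr_le0// opprB distrC => h; apply: inc => //; exact: ltW.
Unshelve. all: by end_near. Qed.

Section solutions.
Variables (R : realType) (n : nat) (M : C1manifold R n).

(** The chain rule through a chart: the velocity determines the derivative of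
every C1 function along the curve. *)
Lemma velocity_C1 c (gamma : R -> M) (t : R) (w : tangent_bundle M)
    (psi : M -> R) :
  gamma s @[s --> t] --> gamma t -> is_velocity gamma t w ->
  chart_dom c (gamma t) -> C1_function psi ->
  is_derive (t : R^o) 1 (psi \o gamma : R^o -> R^o)
    ('d (psi \o chart_inv c : 'rV[R]_n -> R^o) (chart c (gamma t)) (tangent_comp w c)).
Proof.
move=> cg [wt wv] ct /C1_functionP psiC.
have [dg vg] := wv c ct.
have gd : differentiable (chart c \o gamma : R^o -> 'rV[R]_n) t by apply/derivable1_diffP.
have pd := C1at_diff (psiC c _ ct).
have E : \forall s \near t, ((psi \o chart_inv c : 'rV[R]_n -> R^o) \o (chart c \o gamma)) s
    = psi (gamma s).
  have : \forall s \near t, chart_dom c (gamma s) := cg _ (chart_dom_nbhs ct).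
  by apply: filterS => s cs /=; rewrite chartK.
apply: (near_eq_is_derive E).
have cd : differentiable ((psi \o chart_inv c : 'rV[R]_n -> R^o) \o (chart c \o gamma)) (t : R^o).
  exact: differentiable_comp.
apply: DeriveDef; first exact/derivable1_diffP.
have vg' : 'd (chart c \o gamma : R^o -> 'rV[R]_n) t 1 = tangent_comp w c.
  by rewrite -deriveE.
by rewrite deriveE// diff_comp//= vg'.
Qed.

Lemma chart_change_velocity c d (gamma : R -> M) (t : R) (w : tangent_bundle M) :
  gamma s @[s --> t] --> gamma t -> tangent_base w = gamma t ->
  chart_dom c (gamma t) -> chart_dom d (gamma t) ->
  is_derive (t : R^o) 1 (chart c \o gamma : R^o -> 'rV[R]_n) (tangent_comp w c) ->
  is_derive (t : R^o) 1 (chart d \o gamma : R^o -> 'rV[R]_n) (tangent_comp w d).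
Proof.
move=> cg wt ct dt [dg vg].
have gd : differentiable (chart c \o gamma : R^o -> 'rV[R]_n) t by apply/derivable1_diffP.
have pd := C1at_diff (chart_change_C1at ct dt).
have E : \forall s \near t, ((chart d \o chart_inv c) \o (chart c \o gamma)) s
    = (chart d \o gamma) s.
  have : \forall s \near t, chart_dom c (gamma s) := cg _ (chart_dom_nbhs ct).
  by apply: filterS => s cs /=; rewrite chartK.
apply: (near_eq_is_derive E).
have cd : differentiable ((chart d \o chart_inv c) \o (chart c \o gamma)) (t : R^o).
  exact: differentiable_comp.
apply: DeriveDef; first exact/derivable1_diffP.
have vg' : 'd (chart c \o gamma : R^o -> 'rV[R]_n) t 1 = tangent_comp w c.
  by rewrite -deriveE.
rewrite deriveE// diff_comp//= vg'.
by rewrite (tangent_compE (i := c) (j := d)) ?wt.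
Qed.

Variable H : hybrid_system M.
Hypothesis HH : hybrid_basic_conditions H.
Notation FC := (set_valued_restrict (flow_set H) (flow_map H)).
Notation mu := (@lebesgue_measure R).

Section one_solution.
Variable phi : partial_arc M.
Hypothesis solphi : solution H phi.
Notation E := (arc_dom phi).

Lemma slice_interior j a b t : E (a, j) -> E (b, j) -> a < t < b ->
  (arc_slice phi j)° t.
Proof.
move=> Ea Eb atb; apply: (@interiorS _ `]a, b[%classic).
  move=> u /=; rewrite in_itv/= => /andP[au ub].
  by apply: (domain_convex (solution_arc solphi).1 Ea Eb); rewrite !ltW.
apply: open_nbhs_nbhs; split; first exact: interval_open.
by rewrite /= in_itv.
Qed.

Lemma solution_AC j a b (psi : M -> R) : C1_function psi ->
  a <= b -> E (a, j) -> E (b, j) -> abs_continuous_on a b (fun t => psi (phi t j)).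
Proof.
move=> psiC ab Ea Eb; apply: ((solution_arc solphi).2 j psi psiC) => // t /=.
by rewrite in_itv/=; exact: (domain_convex (solution_arc solphi).1 Ea Eb).
Qed.

(** Absolute continuity is only given against C1 functions, but these determine
the topology. *)
Lemma solution_continuous j a b t : E (a, j) -> E (b, j) -> a < t < b ->
  phi s j @[s --> t] --> phi t j.
Proof.
move=> Ea Eb atb; apply: C1_functions_cvg => psi psiC.
have ab : a <= b by case/andP: atb => at_ tb; exact: ltW (lt_trans at_ tb).
exact: abs_continuous_on_cont (solution_AC psiC ab Ea Eb) atb.
Qed.

Lemma solution_velocity j a b : E (a, j) -> E (b, j) ->
  {ae mu, forall t, a < t < b ->
    exists2 w, is_velocity (phi^~ j) t w & FC (phi t j) w}.
Proof.
move=> Ea Eb.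
have [ab|ba] := ltP a b; last first.
  apply: ae_true => t /andP[at_ tb].
  by have := lt_trans at_ tb; rewrite ltNge ba.
have ne : (arc_slice phi j)° !=set0.
  by exists ((a + b) / 2); apply: (slice_interior Ea Eb); apply/andP; split; lra.
apply: ae_imply (solution_flow solphi ne) _ => t Ht atb.
have ti := slice_interior Ea Eb atb.
have [w vw Fw] := Ht (interior_subset ti).
by exists w => //; split=> //; exact: (solution_flow_set solphi ne).
Qed.

End one_solution.

(** Near x, both the components of the flow map and the partial derivatives of psi
are bounded in a fixed chart. *)
Lemma flow_derivative_bounded (psi : M -> R) (x : M) : C1_function psi ->
  exists B, \forall y \near x, forall w, FC y w -> exists2 c, chart_dom c y &
    `|'d (psi \o chart_inv c : 'rV[R]_n -> R^o) (chart c y) (tangent_comp w c)| <= B.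
Proof.
move=> /C1_functionP psiC; have [c cx] := chart_cover x.
have [B0 B0P] := flow_map_bounded HH cx.
pose f : 'rV[R]_n -> R^o := psi \o chart_inv c.
pose D k z : R^o := 'd f z (delta_mx 0 k).
exists (\sum_k B0 * (`|D k (chart c x)| + 1)).
have DB : \forall y \near x, forall k, `|D k (chart c y)| <= `|D k (chart c x)| + 1.
  apply: filter_forall => k.
  have h : {for x, continuous (D k \o chart c)}.
    apply: continuous_comp; first exact: chart_continuous.
    exact: (psiC c x cx).2.
  have /cvgrPdist_le/(_ 1 ltr01) := h; apply: filterS => y /= yD.
  have -> : D k (chart c y) = D k (chart c x) - (D k (chart c x) - D k (chart c y)).
    by rewrite subKr.
  by apply: le_trans (ler_normB _ _) _; rewrite lerD2l.
apply: filterS3 (chart_dom_nbhs cx) B0P DB => y cy B0y By w /B0y wB.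
exists c => //; rewrite -/f (row_sum_delta (tangent_comp w c)) linear_sum.
apply: le_trans (ler_norm_sum _ _ _) _; apply: ler_sum => k _.
rewrite linearZ normrZ; apply: ler_pM => //.
  by apply: le_trans wB; exact: coord_norm_le.
exact: By.
Qed.

Lemma mean_value_scalar (f : R -> R) (a b L : R) :
  a <= b -> 0 <= L -> abs_continuous_on a b f ->
  {ae mu, forall t, a < t < b ->
    exists2 v, is_derive (t : R^o) 1 (f : R^o -> R^o) v & `|v| <= L} ->
  `|f b - f a| <= L * (b - a).
Proof.
move=> ab L0 /abs_continuous_on_seq fac fd; apply/ler_addgt0Pr => e e0.
pose K : set R^o := [set v | `|v| <= L].
have cK : convex_in K.
  move=> s t x y s0 t0 st; rewrite /K/= => xL yL.
  apply: le_trans (ler_normD _ _) _; rewrite !normrZ (ger0_norm s0) (ger0_norm t0).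
  by rewrite -[leRHS]mul1r -st mulrDl; apply: lerD; exact: ler_wpM2l.
have K0 : K !=set0 by exists 0; rewrite /K/= normr0.
have [w wL wE] := mean_value_convex ab cK K0 fac fd e0.
have -> : f b - f a = (b - a) *: w + (f b - f a - (b - a) *: w).
  by rewrite [RHS]addrC subrK.
apply: le_trans (ler_normD _ _) _; apply: lerD => //.
by rewrite normrZ ger0_norm ?subr_ge0// mulrC ler_wpM2r// subr_ge0.
Qed.

(** The derivative of psi along the flow is bounded on the compact closure of the
range, by [flow_derivative_bounded]; the mean value theorem turns this into a
Lipschitz bound valid on every flow interval. *)
Theorem solution_C1_lipschitz (phi : partial_arc M) (psi : M -> R) :
  solution H phi -> precompact_arc phi -> C1_function psi ->
  exists2 L, 0 <= L & forall j s t, arc_dom phi (s, j) -> arc_dom phi (t, j) ->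
    `|psi (phi t j) - psi (phi s j)| <= L * `|t - s|.
Proof.
move=> solphi [K phiK [/compact_near_coveringP cK _]] psiC.
pose P (B : R) (y : M) := forall w, FC y w -> exists2 c, chart_dom c y &
    `|'d (psi \o chart_inv c : 'rV[R]_n -> R^o) (chart c y) (tangent_comp w c)| <= B.
have : \forall B \near +oo, K `<=` P B.
  apply: cK => x _; have [B0 B0P] := flow_derivative_bounded x psiC.
  exists ([set y | P B0 y], [set B | B0 <= B]) => /=.
    by split=> //; apply: nbhs_pinfty_ge; rewrite num_real.
  move=> [y B] /= [yB BB] w /yB[c cy le]; exists c => //; exact: le_trans BB.
move=> KP.
have [L [L0 LP]] : exists L, 0 <= L /\ K `<=` P L.
  near (+oo : set_system R) => L; exists L; split; last by near: L.
  by near: L; apply: nbhs_pinfty_ge; rewrite num_real.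
exists L => // j s t.
wlog st : s t / s <= t.
  move=> Hw Es Et; have [st|/ltW ts] := leP s t; first exact: Hw.
  by rewrite distrC [X in _ * X]distrC; exact: Hw.
move=> Es Et; rewrite [X in _ * X]ger0_norm ?subr_ge0//.
apply: (@mean_value_scalar (fun u => psi (phi u j))) => //.
  exact: solution_AC.
apply: ae_imply (solution_velocity solphi Es Et) _ => u Hu sut.
have [w vw Fw] := Hu sut.
have [c cu cB] : exists2 c, chart_dom c (phi u j) &
    `|'d (psi \o chart_inv c : 'rV[R]_n -> R^o) (chart c (phi u j)) (tangent_comp w c)| <= L.
  apply: LP Fw; apply: phiK; exists (u, j) => //.
  exact: (interior_subset (slice_interior solphi Es Et sut)).
exists ('d (psi \o chart_inv c : 'rV[R]_n -> R^o) (chart c (phi u j)) (tangent_comp w c)) => //.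
apply: velocity_C1 => //; exact: (solution_continuous solphi Es Et).
Unshelve. all: by end_near. Qed.

End solutions.

(** * Mean values of solutions in a chart *)

Section chart_mvt.
Variables (R : realType) (n : nat) (M : C1manifold R n) (H : hybrid_system M).
Hypothesis HH : hybrid_basic_conditions H.
Notation FC := (set_valued_restrict (flow_set H) (flow_map H)).

(** This is what [cutoff] provides: on V every C1 function of the coordinates is
the restriction of a C1 function on the manifold. *)
Definition chart_extension (c : chart_index M) (V : set M) :=
  forall f : 'rV[R]_n -> R^o, (forall z, C1at f z) ->
    exists2 psi : M -> R, C1_function psi & forall y, V y -> psi y = f (chart c y).

Lemma chart_coordinates c V : chart_extension c V ->
  exists psi : 'I_n -> M -> R, (forall k, C1_function (psi k)) /\
    forall k y, V y -> psi k y = chart c y 0 k.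
Proof.
move=> ext; have /choice[psi psiP] : forall k : 'I_n, exists psi : M -> R,
    C1_function psi /\ forall y, V y -> psi y = chart c y 0 k.
  by move=> k; have [psi ? ?] := ext _ (C1at_coord k); exists psi.
by exists psi; split=> k; case: (psiP k).
Qed.

Lemma solution_chart_mean_value (phi : partial_arc M) c V K j a b :
  solution H phi -> chart_extension c V -> V `<=` chart_dom c ->
  convex_in K -> K !=set0 -> a <= b ->
  arc_dom phi (a, j) -> arc_dom phi (b, j) ->
  (forall s, a <= s <= b -> V (phi s j)) ->
  (forall y w, V y -> FC y w -> K (tangent_comp w c)) ->
  forall e, 0 < e -> exists2 w, K w &
    `|chart c (phi b j) - chart c (phi a j) - (b - a) *: w| <= e.
Proof.
move=> solphi /chart_coordinates[psi [psiC psiE]] Vc cK K0 ab Ea Eb phiV FK.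
apply: (@mean_value_convex _ _ (fun s => chart c (phi s j)) K a b) => //.
  apply: abs_continuous_seq_rV => k.
  apply: (@abs_continuous_seq_ext _ _ _ _ (fun s => psi k (phi s j) : R^o)).
    by move=> s sab; apply: psiE; exact: phiV.
  by apply: abs_continuous_on_seq; exact: (solution_AC solphi (psiC k) ab Ea Eb).
apply: ae_imply (solution_velocity solphi Ea Eb) _ => t Ht atb.
have [w [wt wv] Fw] := Ht atb.
have Vt : V (phi t j) by apply: phiV; case/andP: atb => at_ tb; rewrite (ltW at_) (ltW tb).
exists (tangent_comp w c); last exact: FK Fw.
exact: (wv c (Vc _ Vt)).
Qed.

End chart_mvt.

(** * The graph of the jump map *)

Section jump_map.
Variables (R : realType) (n : nat) (M : C1manifold R n) (H : hybrid_system M).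
Hypothesis HH : hybrid_basic_conditions H.

(** Outer semicontinuity speaks of sequences; countable neighborhood bases reduce
convergence along an arbitrary filter to sequences. *)
Lemma jump_map_closed_graph (T : Type) (U : set_system T) (u v : T -> M) x y :
  ProperFilter U -> u i @[i --> U] --> x -> v i @[i --> U] --> y ->
  (\forall i \near U, jump_set H (u i) /\ jump_map H (u i) (v i)) ->
  jump_set H x /\ jump_map H x y.
Proof.
move=> UF ux vy uv.
have [V [Vx Vbase]] := countable_nbhs_base x (@mfd_second_countable _ _ M).
have [W [Wy Wbase]] := countable_nbhs_base y (@mfd_second_countable _ _ M).
have /choice[k kP] : forall l, exists i, [/\ V l (u i), W l (v i),
    jump_set H (u i) & jump_map H (u i) (v i)].
  move=> l; have uV : \forall i \near U, V l (u i) := ux _ (Vx l).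
  have vW : \forall i \near U, W l (v i) := vy _ (Wy l).
  by have [i [? [? []]]] := filter_ex (filterI uV (filterI vW uv)); exists i.
have uk : (u \o k) l @[l --> \oo] --> x.
  move=> A /Vbase[l lA]; exists l => // m /= lm.
  by apply: (lA m lm); case: (kP m).
apply: (jump_map_osc HH uk) => A /Wbase[l lA]; apply/infinite_natP => N.
exists (maxn N l); first exact: leq_maxl.
exists (v (k (maxn N l))); case: (kP (maxn N l)) => _ Wv Du Gu; split=> //.
exact: (lA _ (leq_maxr N l)).
Qed.

End jump_map.

(** * Limits of shifted time domains *)

(** Compactness in the form used for all limits below. *)
Lemma compact_ultra_cvg (X : topologicalType) (T : Type) (U : set_system T)
    (K : set X) (f : T -> X) : UltraFilter U -> compact K ->
  (\forall i \near U, K (f i)) -> exists2 p, K p & f i @[i --> U] --> p.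
Proof.
move=> UF cK fK; have [p [Kp clp]] := cK (f @ U) _ fK.
exists p => // A pA; have [//|nA] := in_ultra_setVsetC (f @^-1` A) UF.
by have [y [ny /ny]] := clp (~` A) A nA pA.
Qed.

Section limit_domain.
Variables (R : realType) (T : nat -> \bar R).
Hypothesis jT : jump_times T.
Variables (tt : nat -> R) (jj : nat -> nat).
Hypothesis ttE : forall i, jump_domain T (tt i, jj i).
Variable U : set_system nat.
Hypothesis UF : UltraFilter U.

(** The limit along U, in the extended reals, of the j-th jump time counted from
the new origin (tt i, jj i); the 0-th one is 0. *)
Definition limit_jump_times (j : nat) : \bar R :=
  ereal_inf [set x%:E | x in [set x | 0 <= x /\
    \forall i \near U, (T (jj i + j)%N <= (tt i + x)%:E)%E]].
Notation Tinf := limit_jump_times.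

Lemma limit_jump_lt j (x : R) : (Tinf j < x%:E)%E ->
  \forall i \near U, (T (jj i + j)%N <= (tt i + x)%:E)%E.
Proof.
move=> /ereal_inf_lt[_ [y [y0 Uy] <-]]; rewrite lte_fin => yx.
by apply: filterS Uy => i /le_trans; apply; rewrite lee_fin lerD2l ltW.
Qed.

Lemma limit_jump_gt j (x : R) : 0 <= x -> (x%:E < Tinf j)%E ->
  \forall i \near U, ((tt i + x)%:E < T (jj i + j)%N)%E.
Proof.
move=> x0 xT.
have [Ux|] := in_ultra_setVsetC [set i | (T (jj i + j)%N <= (tt i + x)%:E)%E] UF.
  move: xT; rewrite ltNge => /negP[]; apply: ereal_inf_lbound; exists x => //.
by apply: filterS => i /= /negP; rewrite -ltNge.
Qed.

Lemma limit_jump_ge0 j : (0 <= Tinf j)%E.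
Proof. by apply: le_ereal_inf_tmp => _ [x [x0 _] <-]; rewrite lee_fin. Qed.

Lemma limit_jump_timesP : jump_times Tinf.
Proof.
split=> [|j].
  apply/eqP; rewrite eq_le limit_jump_ge0 andbT; apply: ereal_inf_lbound.
  exists 0 => //; split => //; apply: filterE => i; rewrite addn0 addr0.
  by have [] := ttE i.
apply: le_ereal_inf_tmp => _ [x [x0 Ux] <-]; apply: ereal_inf_lbound.
exists x => //; split=> //; apply: filterS Ux => i; apply: le_trans.
by rewrite addnS; exact: jT.2.
Qed.

Lemma limit_jump_le (a : nat -> R) (t : R) j : a i @[i --> U] --> t ->
  (\forall i \near U, 0 <= a i /\ (T (jj i + j)%N <= (tt i + a i)%:E)%E) ->
  (Tinf j <= t%:E)%E.
Proof.
move=> at_ aT; apply/lee_addgt0Pr => e e0; apply: ereal_inf_lbound.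
have ae : \forall i \near U, a i <= t + e.
  move/cvgrPdist_le : at_ => /(_ e e0); apply: filterS => i.
  by rewrite distrC ler_norml => /andP[_]; rewrite lerBlDl.
exists (t + e); last by rewrite EFinD.
split.
  by have [i [[a0 _]]] := filter_ex (filterI aT ae); exact: le_trans.
apply: filterS2 aT ae => i [_ aT] ae; apply: le_trans aT _.
by rewrite lee_fin lerD2l.
Qed.

Lemma limit_jump_ge (a : nat -> R) (t : R) j : a i @[i --> U] --> t ->
  (\forall i \near U, ((tt i + a i)%:E <= T (jj i + j)%N)%E) ->
  (t%:E <= Tinf j)%E.
Proof.
move=> at_ aT; rewrite leNgt; apply/negP => Tt.
have fT : Tinf j \is a fin_num.
  rewrite ge0_fin_numE ?limit_jump_ge0//; exact: lt_trans Tt (ltry _).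
pose x := (fine (Tinf j) + t) / 2.
have Tt' : fine (Tinf j) < t by rewrite -lte_fin fineK.
have xt : x < t by rewrite /x; lra.
have Tx : (Tinf j < x%:E)%E by rewrite -(fineK fT) lte_fin /x; lra.
have ax : \forall i \near U, x < a i.
  have tx : 0 < t - x by rewrite subr_gt0.
  move/cvgrPdist_lt : at_ => /(_ _ tx); apply: filterS => i.
  by rewrite ltr_norml => /andP[_]; lra.
have [i [aTi [axi Txi]]] := filter_ex (filterI aT (filterI ax (limit_jump_lt Tx))).
have := le_trans aTi Txi; rewrite lee_fin lerD2l leNgt.
by rewrite axi.
Qed.

(** Strictly inside a flow interval of the limit domain, the shifted domains
contain the same times eventually. *)
Lemma limit_domain_inner j a s s' b :
  jump_domain Tinf (a, j) -> jump_domain Tinf (b, j) ->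
  a < s -> s <= s' -> s' < b ->
  \forall i \near U, jump_domain T (tt i + s, (jj i + j)%N) /\
    jump_domain T (tt i + s', (jj i + j)%N).
Proof.
move=> [/= Ta _] [/= _ bT] as_ ss sb.
have a0 : 0 <= a by rewrite -lee_fin; apply: le_trans Ta; exact: limit_jump_ge0.
have Ts : (Tinf j < s%:E)%E by apply: le_lt_trans Ta _; rewrite lte_fin.
have sT : (s'%:E < Tinf j.+1)%E by apply: lt_le_trans bT; rewrite lte_fin.
have s0 : 0 <= s' by rewrite (le_trans a0)// (le_trans (ltW as_)).
apply: filterS2 (limit_jump_lt Ts) (limit_jump_gt s0 sT) => i Tsi siT.
have ssi : ((tt i + s)%:E <= (tt i + s')%:E)%E by rewrite lee_fin lerD2l.
rewrite addnS in siT.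
split; split=> //=; last exact: ltW.
- exact: le_trans ssi (ltW siT).
- exact: le_trans Tsi ssi.
Qed.

Lemma limit_jump_cvg j (t : R) : Tinf j.+1 = t%:E ->
  exists2 a : nat -> R, a i @[i --> U] --> t &
    \forall i \near U, [/\ 0 <= a i, T (jj i + j.+1)%N = (tt i + a i)%:E &
    T (jj i + j.+1)%N \is a fin_num].
Proof.
move=> Tt; pose a i := fine (T (jj i + j.+1)%N) - tt i.
have T1 : (Tinf j.+1 < (t + 1)%:E)%E by rewrite Tt lte_fin ltrDl.
have fT : \forall i \near U, T (jj i + j.+1)%N \is a fin_num.
  apply: filterS (limit_jump_lt T1) => i Ti.
  rewrite ge0_fin_numE ?jump_times_ge0//; exact: le_lt_trans Ti (ltry _).
have aE : \forall i \near U, [/\ 0 <= a i, T (jj i + j.+1)%N = (tt i + a i)%:E &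
    T (jj i + j.+1)%N \is a fin_num].
  apply: filterS fT => i fT; have aE : T (jj i + j.+1)%N = (tt i + a i)%:E.
    by rewrite /a addrC subrK fineK.
  split=> //; rewrite /a subr_ge0 -lee_fin fineK//.
  have [/= _ tT] := ttE i; apply: le_trans tT _.
  by apply: jump_times_mono => //; rewrite addnS ltnS leq_addr.
exists a => //; apply/cvgrPdist_le => e e0.
have Te : (Tinf j.+1 < (t + e)%:E)%E by rewrite Tt lte_fin ltrDl.
have up : \forall i \near U, a i <= t + e.
  apply: filterS2 aE (limit_jump_lt Te) => i [_ -> _].
  by rewrite lee_fin lerD2l.
have lo : \forall i \near U, t - e <= a i.
  have [te|te] := leP 0 (t - e); last first.
    by apply: filterS aE => i [a0 _ _]; rewrite (le_trans (ltW te)).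
  have eT : ((t - e)%:E < Tinf j.+1)%E by rewrite Tt lte_fin ltrBlDr ltrDl.
  apply: filterS2 aE (limit_jump_gt te eT) => i [_ -> _].
  by rewrite lte_fin ltrD2l => /ltW.
apply: filterS2 lo up => i lo up; rewrite ler_norml; lra.
Qed.

(** Every point of the limit domain is a limit of points of the shifted domains:
the time t is moved into the j-th interval of the shifted domain, to the endpoint
nearest to it if it lies outside. *)
Lemma limit_domain_approx j (t : R) : jump_domain Tinf (t, j) ->
  exists2 a : nat -> R, a i @[i --> U] --> t &
    \forall i \near U, 0 <= a i /\ jump_domain T (tt i + a i, (jj i + j)%N).
Proof.
move=> [/= Tt tT].
have t0 : 0 <= t by rewrite -lee_fin; apply: le_trans Tt; exact: limit_jump_ge0.
pose a i := if (T (jj i + j.+1)%N <= (tt i + t)%:E)%E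
  then fine (T (jj i + j.+1)%N) - tt i
  else if ((tt i + t)%:E <= T (jj i + j)%N)%E then fine (T (jj i + j)%N) - tt i
  else t.
have T1 : (Tinf j < (t + 1)%:E)%E by apply: le_lt_trans Tt _; rewrite lte_fin ltrDl.
have fin i k (x : R) : (T k <= x%:E)%E -> T k \is a fin_num.
  move=> Tx; rewrite ge0_fin_numE ?jump_times_ge0//; exact: le_lt_trans Tx (ltry _).
have monoT i : (T (jj i + j)%N <= T (jj i + j.+1)%N)%E.
  by rewrite addnS; exact: jT.2.
have aP : \forall i \near U, [/\ 0 <= a i,
    (T (jj i + j)%N <= (tt i + a i)%:E <= T (jj i + j.+1)%N)%E &
    [\/ (tt i + a i)%:E = T (jj i + j.+1)%N /\ a i <= t,
        (tt i + a i)%:E = T (jj i + j)%N /\ t <= a i | a i = t]].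
  apply: filterS (limit_jump_lt T1) => i Ti1; rewrite /a.
  case: ifPn => [Tit|nTit].
    have fT : T (jj i + j.+1)%N \is a fin_num by exact: fin Tit.
    have aE : (tt i + (fine (T (jj i + j.+1)%N) - tt i))%:E = T (jj i + j.+1)%N.
      by rewrite addrC subrK fineK.
    split.
    - rewrite subr_ge0 -lee_fin fineK//; have [/= _ h] := ttE i.
      by apply: le_trans h _; apply: jump_times_mono => //; rewrite addnS ltnS leq_addr.
    - by rewrite aE monoT lexx.
    - by apply: Or31; split=> //; rewrite lerBlDl -lee_fin fineK.
  rewrite -ltNge in nTit; case: ifPn => [tTi|].
    have fT : T (jj i + j)%N \is a fin_num by exact: fin Ti1.
    have aE : (tt i + (fine (T (jj i + j)%N) - tt i))%:E = T (jj i + j)%N.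
      by rewrite addrC subrK fineK.
    have ta : t <= fine (T (jj i + j)%N) - tt i by rewrite lerBrDl -lee_fin fineK.
    split; [exact: le_trans ta|by rewrite aE monoT lexx|by apply: Or32].
  rewrite -ltNge => Tti; split=> //; last exact: Or33.
  by rewrite !ltW.
exists a; last first.
  by apply: filterS aP => i [a0 /andP[Ta aT] _]; split => //; split=> //=; rewrite -addnS.
apply/cvgrPdist_le => e e0.
have Te : (Tinf j < (t + e)%:E)%E by apply: le_lt_trans Tt _; rewrite lte_fin ltrDl.
have lo : \forall i \near U, t - e < 0 \/ ((tt i + (t - e))%:E < T (jj i + j.+1)%N)%E.
  have [te|te] := leP 0 (t - e); last by apply: filterE => i; left.
  have eT : ((t - e)%:E < Tinf j.+1)%E.
    by apply: lt_le_trans tT; rewrite lte_fin ltrBlDr ltrDl.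
  by apply: filterS (limit_jump_gt te eT) => i; right.
apply: filterS3 aP lo (limit_jump_lt Te) => i [a0 _ ai] lo up.
rewrite ler_norml; case: ai => [[aE at_]|[aE ta]| ->]; last lra.
  by case: lo => [|]; rewrite -?aE ?lte_fin ?ltrD2l; lra.
by move: up; rewrite -aE lee_fin lerD2l; lra.
Qed.

End limit_domain.

(** * The limit arc is a solution *)

Section limit_arc.
Variables (R : realType) (n : nat) (M : C1manifold R n) (H : hybrid_system M).
Hypothesis HH : hybrid_basic_conditions H.
Variable phi : partial_arc M.
Hypothesis solphi : solution H phi.
Hypothesis pphi : precompact_arc phi.
Variable T : nat -> \bar R.
Hypothesis jT : jump_times T.
Hypothesis domT : arc_dom phi = jump_domain T.
Variables (tt : nat -> R) (jj : nat -> nat).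
Hypothesis ttE : forall i, arc_dom phi (tt i, jj i).
Variable U : set_system nat.
Hypothesis UF : UltraFilter U.
Notation FC := (set_valued_restrict (flow_set H) (flow_map H)).
Notation mu := (@lebesgue_measure R).
Notation Tinf := (limit_jump_times T tt jj U).
Notation E := (arc_dom phi).

Let ttT i : jump_domain T (tt i, jj i).
Proof. by rewrite -domT. Qed.

(** Membership of (t, j, p) in the limit of the graphs of the shifted arcs. *)
Definition graph_limit (t : R) (j : nat) (p : M) :=
  exists a : nat -> R, [/\ a i @[i --> U] --> t,
    \forall i \near U, 0 <= a i /\ E (tt i + a i, (jj i + j)%N) &
    phi (tt i + a i) (jj i + j)%N @[i --> U] --> p].

Definition limit_arc : partial_arc M :=
  {| arc_dom := jump_domain Tinf;
     arc_fun := fun t j => xget (phi 0 0%N) (graph_limit t j) |}.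

(** Uniform Lipschitz bounds pass to the limit, even between limits taken at
different times; at equal times this gives uniqueness of the limit. *)
Lemma graph_limit_lipschitz (psi : M -> R) (L : R) : 0 <= L -> C1_function psi ->
  (forall j s t, E (s, j) -> E (t, j) ->
    `|psi (phi t j) - psi (phi s j)| <= L * `|t - s|) ->
  forall j s t p q, graph_limit s j p -> graph_limit t j q ->
    `|psi q - psi p| <= L * `|t - s|.
Proof.
move=> L0 psiC psiL j s t p q [a [as_ aE ap]] [b [bt bE bq]].
have psic := C1_function_continuous psiC.
have lhs : `|psi (phi (tt i + b i) (jj i + j)%N) - psi (phi (tt i + a i) (jj i + j)%N)|
    @[i --> U] --> `|psi q - psi p|.
  apply: cvg_norm; apply: cvgB.
    exact: (cvg_comp _ _ bq (psic q)).
  exact: (cvg_comp _ _ ap (psic p)).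
have rhs : L * `|b i - a i| @[i --> U] --> L * `|t - s|.
  by apply: cvgM; [exact: cvg_cst|apply: cvg_norm; exact: cvgB].
apply: ler_cvg_to lhs rhs _.
apply: filterS2 aE bE => i [_ Ea] [_ Eb].
have -> : b i - a i = (tt i + b i) - (tt i + a i) by rewrite opprD addrACA subrr add0r.
exact: psiL.
Qed.

Lemma graph_limit_unique t j p q : graph_limit t j p -> graph_limit t j q -> p = q.
Proof.
move=> tp tq; apply: C1_functions_separate => psi psiC.
have [L L0 psiL] := solution_C1_lipschitz HH solphi pphi psiC.
have := graph_limit_lipschitz L0 psiC psiL tp tq.
by rewrite subrr normr0 mulr0 normr_le0 subr_eq0 => /eqP.
Qed.

Lemma graph_limit_dom t j p : graph_limit t j p -> jump_domain Tinf (t, j).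
Proof.
move=> [a [at_ aE _]]; split => /=.
  apply: (limit_jump_le UF at_); apply: filterS aE => i [a0].
  by rewrite domT => -[].
apply: (limit_jump_ge UF at_).
by apply: filterS aE => i [a0]; rewrite domT addnS => -[].
Qed.

Lemma graph_limit_ex (a : nat -> R) t j : a i @[i --> U] --> t ->
  (\forall i \near U, 0 <= a i /\ E (tt i + a i, (jj i + j)%N)) ->
  exists2 p, graph_limit t j p & phi (tt i + a i) (jj i + j)%N @[i --> U] --> p.
Proof.
move=> at_ aE; have [K phiK [cK _]] := pphi.
have [p Kp ap] : exists2 p, K p & phi (tt i + a i) (jj i + j)%N @[i --> U] --> p.
  apply: compact_ultra_cvg => //; apply: filterS aE => i [_ Ei].
  by apply: phiK; exists (tt i + a i, (jj i + j)%N).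
by exists p => //; exists a.
Qed.

Lemma limit_arcE t j p : graph_limit t j p -> limit_arc t j = p.
Proof.
move=> tp; rewrite /limit_arc/=; case: xgetP => [q -> tq|/(_ p)//].
exact: graph_limit_unique tq tp.
Qed.

Lemma limit_arcP t j : arc_dom limit_arc (t, j) -> graph_limit t j (limit_arc t j).
Proof.
move=> /(limit_domain_approx jT ttT UF)[a at_ aE].
rewrite -domT in aE.
by have [p tp _] := graph_limit_ex at_ aE; rewrite (limit_arcE tp).
Qed.

Lemma limit_arc_cvg (a : nat -> R) t j : a i @[i --> U] --> t ->
  (\forall i \near U, 0 <= a i /\ E (tt i + a i, (jj i + j)%N)) ->
  phi (tt i + a i) (jj i + j)%N @[i --> U] --> limit_arc t j.
Proof.
move=> at_ aE; have [p tp ap] := graph_limit_ex at_ aE.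
by rewrite (limit_arcE tp).
Qed.

Lemma limit_arc_C1_lipschitz (psi : M -> R) : C1_function psi ->
  exists2 L, 0 <= L & forall j s t, arc_dom limit_arc (s, j) ->
    arc_dom limit_arc (t, j) ->
    `|psi (limit_arc t j) - psi (limit_arc s j)| <= L * `|t - s|.
Proof.
move=> psiC; have [L L0 psiL] := solution_C1_lipschitz HH solphi pphi psiC.
exists L => // j s t /limit_arcP sp /limit_arcP tp.
exact: (graph_limit_lipschitz L0 psiC psiL sp tp).
Qed.

Lemma limit_jump_timesT : jump_times Tinf.
Proof. exact (limit_jump_timesP jT ttT UF). Qed.

Lemma limit_arc_hybrid : hybrid_arc limit_arc.
Proof.
split; first exact: (jump_domain_hybrid limit_jump_timesT).
move=> j psi psiC a b ab abI.
have [L L0 psiL] := limit_arc_C1_lipschitz psiC.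
apply: (lipschitz_abs_continuous L0) => s t as_ st tb /=.
rewrite -[t - s]ger0_norm ?subr_ge0//; apply: psiL; apply: abI => /=;
  rewrite in_itv/=.
  by rewrite as_ (le_trans st).
by rewrite tb (le_trans as_).
Qed.

Lemma limit_arc_near j t V : arc_dom limit_arc (t, j) -> nbhs (limit_arc t j) V ->
  exists2 d, 0 < d & forall s, arc_dom limit_arc (s, j) -> `|s - t| < d ->
    V (limit_arc s j).
Proof.
move=> Et tV; have [beta betaC [b1 b0]] := bump_function tV.
have [L L0 bL] := limit_arc_C1_lipschitz betaC.
have L10 : 0 < L + 1 by rewrite ltr_wpDl.
exists (L + 1)^-1; first by rewrite invr_gt0.
move=> s Es st; apply: contrapT => /b0 bs.
have := bL j t s Et Es; rewrite bs (nbhs_singleton b1) sub0r normrN normr1.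
rewrite leNgt => /negP[]; apply: (@le_lt_trans _ _ ((L + 1) * `|s - t|)).
  by apply: ler_wpM2r => //; rewrite lerDl.
by rewrite mulrC -ltr_pdivlMr// mul1r.
Qed.

Lemma limit_arc_inner j a t b : arc_dom limit_arc (a, j) ->
  arc_dom limit_arc (b, j) -> a < t < b ->
  flow_set H (limit_arc t j) /\ arc_dom limit_arc (t, j).
Proof.
move=> Ea Eb /andP[at_ tb].
have Et : arc_dom limit_arc (t, j).
  by apply: (domain_convex limit_arc_hybrid.1 Ea Eb); rewrite !ltW.
split=> //.
pose s := (a + t) / 2; pose s' := (t + b) / 2.
have as_ : a < s by rewrite /s; lra.
have st : s < t by rewrite /s; lra.
have ts : t < s' by rewrite /s'; lra.
have sb : s' < b by rewrite /s'; lra.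
have ss : s <= s' by exact: ltW (lt_trans st ts).
have inn := limit_domain_inner UF Ea Eb as_ ss sb.
have t0 : 0 <= t := domain_ge0 limit_arc_hybrid.1 Et.
have cvt : phi (tt i + t) (jj i + j)%N @[i --> U] --> limit_arc t j.
  apply: (@limit_arc_cvg (fun=> t)); first exact: cvg_cst.
  apply: filterS inn => i; rewrite -domT => -[Es Es']; split => //.
  apply: (domain_convex (solution_arc solphi).1 Es Es').
  by rewrite !lerD2l !ltW.
apply: (closed_cvg _ (flow_set_closed HH) _ _ cvt).
apply: filterS inn => i; rewrite -domT => -[Es Es'].
have ti : tt i + s < tt i + t < tt i + s' by rewrite !ltrD2l st.
have it := slice_interior solphi Es Es' ti.
by apply: (solution_flow_set solphi _ it); exists (tt i + t).
Qed.

Lemma limit_arc_jump t j : arc_dom limit_arc (t, j) ->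
  arc_dom limit_arc (t, j.+1) ->
  jump_set H (limit_arc t j) /\ jump_map H (limit_arc t j) (limit_arc t j.+1).
Proof.
move=> [/= Tt tT] [/= Tt' tT'].
have TE : Tinf j.+1 = t%:E by apply/eqP; rewrite eq_le Tt' tT.
have [a at_ aP] := limit_jump_cvg jT ttT UF TE.
have aE : \forall i \near U, 0 <= a i /\ E (tt i + a i, (jj i + j)%N).
  apply: filterS aP => i [a0 Ta fT]; split=> //; rewrite domT; split=> /=.
    by rewrite -Ta addnS; exact: jT.2.
  by rewrite -addnS Ta.
have aE' : \forall i \near U, 0 <= a i /\ E (tt i + a i, (jj i + j.+1)%N).
  apply: filterS aP => i [a0 Ta fT]; split=> //; rewrite domT; split=> /=.
    by rewrite Ta.
  by rewrite -Ta; exact: jT.2.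
apply: (jump_map_closed_graph HH _ (limit_arc_cvg at_ aE) (limit_arc_cvg at_ aE')).
apply: filterS2 aE aE' => i [_ Ei] [_ Ei'].
by move: Ei'; rewrite addnS => Ei'; exact: (solution_jump solphi).
Qed.

(** For a small step h and an index i far along U, the arc phi shifted by
(tt i, jj i) stays near x between t and t + h, so by
[solution_chart_mean_value] its increment is within e * h of h times a point of
the e-neighborhood of F(x). The increment of the limit arc differs from it by at
most e * h, and from h times the derivative by at most e * h. *)
Lemma limit_arc_derivative j a t b c v : arc_dom limit_arc (a, j) ->
  arc_dom limit_arc (b, j) -> a < t < b -> chart_dom c (limit_arc t j) ->
  is_derive (t : R^o) 1 (fun s : R^o => chart c (limit_arc s j)) v ->
  exists2 w, FC (limit_arc t j) w & tangent_comp w c = v.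
Proof.
move=> Ea Eb atb ct /is_deriveP dv; have [Ct Et] := limit_arc_inner Ea Eb atb.
have t0 : 0 <= t := domain_ge0 limit_arc_hybrid.1 Et.
pose x := limit_arc t j.
pose K0 := (fun w : tangent_bundle M => tangent_comp w c) @` FC x.
have cK0 : closed K0.
  by apply: compact_closed; [exact: norm_hausdorff|exact: flow_map_compact].
suff : closure K0 v by rewrite -((closure_id _).1 cK0) => -[w Fw wv]; exists w.
move=> B /nbhs_ballP[eps/= eps0 epsB].
pose e := eps / 5; have e0 : 0 < e by rewrite divr_gt0.
have [V xV [VW ext0]] := cutoff ct (flow_map_usc HH ct e0).
have Vc : V `<=` chart_dom c by move=> y /VW[].
have ext : chart_extension c V.
  by move=> f /ext0[psi psiC [psiE _]]; exists psi.
have [beta betaC [b1 b0]] := bump_function xV.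
have [L L0 bL] := solution_C1_lipschitz HH solphi pphi betaC.
have L10 : 0 < L + 1 by rewrite ltr_wpDl.
have [d d0 dd] := dv _ e0.
have [d2 d20 dV] := limit_arc_near Et xV.
have [/andP[at_ tb] LL] : a < t < b /\ 0 < (2 * (L + 1))^-1.
  by split=> //; rewrite invr_gt0 mulr_gt0.
(* The bound (2 * (L + 1))^-1 keeps beta, which is L-Lipschitz along phi,
   positive from a value above 1 / 2, so that the arcs stay in V. *)
pose h := Num.min (Num.min d d2) (Num.min (2 * (L + 1))^-1 (b - t)) / 2.
have [h0 hd hd2 hL hb] : [/\ 0 < h, h < d, h < d2, h < (2 * (L + 1))^-1 & h < b - t].
  pose m := Num.min (Num.min d d2) (Num.min (2 * (L + 1))^-1 (b - t)).
  have m0 : 0 < m by rewrite !lt_min d0 d20 LL subr_gt0 tb.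
  have hm : h < m by rewrite /h -/m; lra.
  split; first by rewrite divr_gt0.
  - by apply: lt_le_trans hm _; rewrite !ge_min lexx.
  - by apply: lt_le_trans hm _; rewrite !ge_min lexx orbT.
  - by apply: lt_le_trans hm _; rewrite !ge_min lexx !orbT.
  - by apply: lt_le_trans hm _; rewrite !ge_min lexx !orbT.
pose s := t + h.
have ts : t < s by rewrite ltrDl.
have sb : s < b by rewrite /s -ltrBrDl.
have asb : a < s < b by rewrite (lt_trans at_ ts).
have st : s - t = h by rewrite /s addrAC subrr add0r.
have [Cs Es] := limit_arc_inner Ea Eb asb.
have Vs : V (limit_arc s j) by apply: dV => //; rewrite st gtr0_norm.
(* the approximating arcs on the interval from t to s *)
have inn := limit_domain_inner UF Ea Eb at_ (ltW ts) sb.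
rewrite -domT in inn.
have cvt : phi (tt i + t) (jj i + j)%N @[i --> U] --> x.
  apply: (@limit_arc_cvg (fun=> t)); first exact: cvg_cst.
  by apply: filterS inn => i [].
have cvs : phi (tt i + s) (jj i + j)%N @[i --> U] --> limit_arc s j.
  apply: (@limit_arc_cvg (fun=> s)); first exact: cvg_cst.
  by apply: filterS inn => i []; split=> //; rewrite (le_trans t0)// ltW.
have cht := cvg_comp _ _ cvt (chart_continuous ct).
have chs := cvg_comp _ _ cvs (chart_continuous (Vc _ Vs)).
have eh : 0 < e * h by rewrite mulr_gt0.
have diff : \forall i \near U,
    `|chart c (limit_arc s j) - chart c x - (chart c (phi (tt i + s) (jj i + j)%N) -
      chart c (phi (tt i + t) (jj i + j)%N))| <= e * h.
  have cvd : chart c (phi (tt i + s) (jj i + j)%N) - chart c (phi (tt i + t) (jj i + j)%N)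
      @[i --> U] --> chart c (limit_arc s j) - chart c x by exact: cvgB chs cht.
  by move/cvgrPdist_le : cvd; exact.
have half : \forall i \near U, 1 / 2 < beta (phi (tt i + t) (jj i + j)%N).
  have cvb : beta (phi (tt i + t) (jj i + j)%N) @[i --> U] --> beta x.
    exact: cvg_comp cvt (C1_function_continuous betaC (x := x)).
  have h2 : 0 < 1 / 2 :> R by rewrite divr_gt0.
  move/cvgrPdist_lt : cvb => /(_ _ h2); apply: filterS => i /=.
  by rewrite (nbhs_singleton b1) ltr_norml => /andP[_]; lra.
have [i [[Eti Esi] [difi halfi]]] := filter_ex (filterI inn (filterI diff half)).
set t1 := tt i + t in Eti difi halfi; set s1 := tt i + s in Esi difi.
have s1t1 : s1 - t1 = h by rewrite /s1 /t1 opprD addrACA subrr add0r.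
have phiV u : t1 <= u <= s1 -> V (phi u (jj i + j)%N).
  move=> /andP[tu us].
  have Eu : E (u, (jj i + j)%N).
    by apply: (domain_convex (solution_arc solphi).1 Eti Esi); rewrite tu.
  apply: contrapT => /b0 bu; have := bL _ _ _ Eti Eu.
  rewrite bu sub0r normrN ger0_norm; last by apply: ltW; apply: lt_trans halfi; rewrite divr_gt0.
  rewrite ger0_norm ?subr_ge0// leNgt => /negP[]; apply: le_lt_trans halfi.
  apply: (@le_trans _ _ ((L + 1) * (2 * (L + 1))^-1)).
    apply: ler_pM => //; rewrite ?subr_ge0// ?lerDl//.
    by apply: le_trans (ltW hL); rewrite -s1t1 lerB.
  by rewrite invfM mulrCA divff ?gt_eqF// mulr1 div1r.
pose K := [set w : 'rV[R]_n | exists2 w0, K0 w0 & `|w - w0| <= e].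
have K0n : K0 !=set0.
  by have [w Fw] := flow_set_dom HH Ct; exists (tangent_comp w c); exists w.
have cK : convex_in K.
  move=> p q y z p0 q0 pq [y0 Ky0 yy0] [z0 Kz0 zz0].
  exists (p *: y0 + q *: z0); first exact: flow_map_convex_comp.
  rewrite opprD addrACA -!scalerBr; apply: le_trans (ler_normD _ _) _.
  rewrite !normrZ (ger0_norm p0) (ger0_norm q0) -[leRHS]mul1r -pq mulrDl.
  by apply: lerD; exact: ler_wpM2l.
have Kn : K !=set0.
  by have [w Kw] := K0n; exists w; exists w; rewrite // subrr normr0 ltW.
have FK y w : V y -> FC y w -> K (tangent_comp w c).
  move=> /VW[yW _] Fw; have [w0 Fw0 ww0] := yW w Fw.
  by exists (tangent_comp w0 c); [exists w0|exact: ltW].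
have ts1 : t1 <= s1 by rewrite lerD2l ltW.
have [w [w0 Kw0 ww0] wE] := solution_chart_mean_value solphi ext Vc cK Kn ts1
  Eti Esi phiV FK eh.
exists w0; split=> //; apply: epsB; rewrite -ball_normE/=.
have := dd s; rewrite st (gtr0_norm h0) => /(_ hd) dds.
rewrite s1t1 in wE.
have : `|h *: (v - w0)| <= 4 * (e * h).
  have -> : h *: (v - w0) = - (chart c (limit_arc s j) - chart c x - h *: v)
      + (chart c (limit_arc s j) - chart c x - (chart c (phi s1 (jj i + j)%N) -
      chart c (phi t1 (jj i + j)%N)))
      + (chart c (phi s1 (jj i + j)%N) - chart c (phi t1 (jj i + j)%N) - h *: w)
      + h *: (w - w0).
    by rewrite !scalerBr opprB !subrKA.
  have hw : `|h *: (w - w0)| <= e * h by rewrite normrZ gtr0_norm// mulrC ler_wpM2r// ltW.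
  have -> : 4 * (e * h) = e * h + e * h + e * h + e * h by ring.
  do 3 (apply: le_trans (ler_normD _ _) _; apply: lerD => //).
  by rewrite normrN.
rewrite normrZ gtr0_norm// mulrA [h * _]mulrC ler_pM2r// => h4.
by apply: le_lt_trans h4 _; rewrite /e; lra.
Qed.

Lemma limit_arc_velocity j a t b c : arc_dom limit_arc (a, j) ->
  arc_dom limit_arc (b, j) -> a < t < b -> chart_dom c (limit_arc t j) ->
  derivable (fun s : R^o => chart c (limit_arc s j)) (t : R^o) 1 ->
  exists2 w, is_velocity (limit_arc^~ j) t w & flow_map H (limit_arc t j) w.
Proof.
move=> Ea Eb atb ct /derivableP dt.
have [w Fw wv] := limit_arc_derivative Ea Eb atb ct dt.
have wt := flow_base Fw; exists w; last by case: Fw.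
split=> // d dt'; rewrite -wv in dt.
apply: chart_change_velocity dt => // V tV.
have [_ Et] := limit_arc_inner Ea Eb atb.
have [r r0 rV] := limit_arc_near Et tV.
case/andP: atb => at_ tb.
suff : \forall s \near t, V (limit_arc s j) by [].
near=> s; apply: rV.
  apply: (domain_convex limit_arc_hybrid.1 Ea Eb); apply/andP; split; apply: ltW; near: s.
    exact: lt_nbhsr.
  exact: lt_nbhsl.
by rewrite distrC; near: s; apply: (@cvgr_dist_lt _ R^o); [exact: cvg_id|].
Unshelve. all: by end_near. Qed.

(** Around each point the coordinates of the limit arc are restrictions of C1
functions, hence Lipschitz in time; [cousin_induction] glues the exceptional
sets. *)
Lemma limit_arc_ae_derivable j a b : a <= b -> arc_dom limit_arc (a, j) ->
  arc_dom limit_arc (b, j) ->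
  {ae mu, forall t, a < t < b -> exists2 c, chart_dom c (limit_arc t j) &
     derivable (fun s : R^o => chart c (limit_arc s j)) (t : R^o) 1}.
Proof.
move=> ab Ea Eb.
pose P u v := {ae mu, forall t, u < t < v ->
  exists2 c, chart_dom c (limit_arc t j) &
     derivable (fun s : R^o => chart c (limit_arc s j)) (t : R^o) 1}.
apply: (cousin_induction (P := P) ab).
  move=> u c v au uc cv vb Puc Pcv.
  apply: ae_imply2 (ae_neq c) (ae_imply2 Puc Pcv (fun t => @conj _ _)) _.
  move=> t /= tc [Puct Pcvt] /andP[ut tv].
  move: tc; rewrite neq_lt => /orP[tc|ct]; first by apply: Puct; rewrite ut.
  by apply: Pcvt; rewrite ct.
move=> t0 atb; have Et0 : arc_dom limit_arc (t0, j).
  exact: (domain_convex limit_arc_hybrid.1 Ea Eb).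
have [c cx] := chart_cover (limit_arc t0 j).
have [V xV [VW ext0]] := cutoff cx filterT.
have ext : chart_extension c V.
  by move=> f /ext0[psi psiC [psiE _]]; exists psi.
have [psi [psiC psiE]] := chart_coordinates ext.
have [d d0 dV] := limit_arc_near Et0 xV.
exists d => // u v au ut tv vb vu.
have Ein s : u <= s <= v -> arc_dom limit_arc (s, j).
  move=> /andP[us sv]; apply: (domain_convex limit_arc_hybrid.1 Ea Eb).
  by rewrite (le_trans au us) (le_trans sv vb).
have Vin s : u <= s <= v -> V (limit_arc s j).
  move=> usv; apply: dV; first exact: Ein.
  by case/andP: usv => us sv; rewrite ltr_norml; apply/andP; split; lra.
have /choice[L LP] : forall k, exists L, 0 <= L /\ forall s t,
    arc_dom limit_arc (s, j) -> arc_dom limit_arc (t, j) ->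
    `|psi k (limit_arc t j) - psi k (limit_arc s j)| <= L * `|t - s|.
  by move=> k; have [L L0 LP] := limit_arc_C1_lipschitz (psiC k); exists L; split=> // s t; exact: LP.
have lip s t : u <= s -> s <= t -> t <= v ->
    `|chart c (limit_arc t j) - chart c (limit_arc s j)| <= (\sum_k L k) * (t - s).
  move=> us st tv'.
  have us' : u <= s <= v by rewrite us (le_trans st).
  have ut' : u <= t <= v by rewrite tv' (le_trans us).
  apply: le_trans (norm_rV_le_sum _) _; rewrite mulr_suml.
  apply: ler_sum => k _; rewrite mxE [X in _ + X]mxE -!psiE//; try exact: Vin.
  rewrite -[t - s]ger0_norm ?subr_ge0//.
  by apply: (LP k).2; exact: Ein.
apply: ae_imply (lipschitz_rV_ae_derivable lip) _ => t Ht utv.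
exists c; last exact: Ht.
by have /VW[] : V (limit_arc t j) by apply: Vin; case/andP: utv => /ltW-> /ltW->.
Qed.

(** The flow interval is a countable union of compact intervals starting at its
left endpoint s, plus endpoints; e is its right endpoint when that is finite. *)
Lemma limit_arc_flow j : {ae mu, forall t, arc_slice limit_arc j t ->
  exists2 w, is_velocity (limit_arc^~ j) t w & flow_map H (limit_arc t j) w}.
Proof.
have [[a Ea]|nE] := pselect (exists a, arc_dom limit_arc (a, j)); last first.
  by apply: ae_true => t Et; exfalso; apply: nE; exists t.
have [s [Es smin _ _]] := domain_slice_min limit_arc_hybrid.1 Ea.
pose Good t := exists2 w, is_velocity (limit_arc^~ j) t w & flow_map H (limit_arc t j) w.
have goodP b : arc_dom limit_arc (b, j) -> {ae mu, forall t, s < t < b -> Good t}.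
  move=> Eb; apply: ae_imply (limit_arc_ae_derivable (smin _ Eb) Es Eb) _ => t Ht stb.
  by have [c ct dt] := Ht stb; exact: (limit_arc_velocity Es Eb stb ct dt).
pose e := fine (Tinf j.+1).
pose P k t : Prop := match k with 0%N => is_true (t != s) | 1%N => is_true (t != e) |
  2%N => arc_dom limit_arc (e, j) -> s < t < e -> Good t |
  k.+3 => arc_dom limit_arc (s + k%:R, j) -> s < t < s + k%:R -> Good t end.
have aeP k : {ae mu, forall t, P k t}.
  have sliceP (b : R) : {ae mu, forall t, arc_dom limit_arc (b, j) -> s < t < b -> Good t}.
    have [Eb|nb] := pselect (arc_dom limit_arc (b, j)).
      by apply: ae_imply (goodP _ Eb) _ => t Ht _.
    by apply: ae_true.
  case: k => [|[|[|k]]]; rewrite /P; [exact: ae_neq|exact: ae_neq|exact: sliceP|exact: sliceP].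
apply: ae_imply (ae_forall_nat aeP) _ => t Ht Et.
have st : s < t by rewrite lt_neqAle smin// andbT eq_sym (Ht 0%N).
have [fT|] := boolP (Tinf j.+1 \is a fin_num).
  have eT : e%:E = Tinf j.+1 by rewrite /e fineK.
  have Ee : arc_dom limit_arc (e, j).
    by split; rewrite /= eT//; exact: limit_jump_timesT.2.
  apply: (Ht 2%N Ee); rewrite st lt_neqAle (Ht 1%N)/=.
  by rewrite -lee_fin eT; case: Et.
rewrite fin_numE negb_and !negbK => /orP[/eqP TE|/eqP TE].
  by have := jump_times_ge0 limit_jump_timesT j.+1; rewrite TE.
pose k := (Num.truncn (t - s)).+1.
have tk : t < s + k%:R by rewrite -ltrBlDl; exact: Num.Theory.truncnS_gt.
apply: (Ht k.+3); last by rewrite st.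
split; rewrite /= ?TE ?leey//; case: Et => /= Tt _; apply: le_trans Tt _.
by rewrite lee_fin ltW.
Qed.

(** At the origin the limit arc either jumps at once, or flows in the flow set on
an interval and so starts in its closure. *)
Theorem limit_arc_solution : unbounded_domain (arc_dom limit_arc) /\ solution H limit_arc.
Proof.
split; first exact: (jump_domain_unbounded limit_jump_timesT).
have int j t : (arc_slice limit_arc j)° t -> exists a b,
    [/\ arc_dom limit_arc (a, j), arc_dom limit_arc (b, j) & a < t < b].
  move=> /nbhs_ballP[r /= r0 rE]; exists (t - r / 2), (t + r / 2).
  split; last by apply/andP; split; lra.
    by apply: rE; rewrite /ball/= ltr_norml; lra.
  by apply: rE; rewrite /ball/= ltr_norml; lra.
split.
- exact: limit_arc_hybrid.
- have [T1|T1] := leP (Tinf 1%N) 0%E.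
    right; have E0 : arc_dom limit_arc (0, 0%N).
      exact: domain_origin limit_arc_hybrid.1.
    have E1 : arc_dom limit_arc (0, 1%N).
      split=> //=; apply: le_trans (limit_jump_timesT.2 1%N).
      exact: limit_jump_ge0.
    by have [] := limit_arc_jump E0 E1.
  left; have E0 := domain_origin limit_arc_hybrid.1.
  have [b b0 Eb] : exists2 b, 0 < b & arc_dom limit_arc (b, 0%N).
    case TE : (Tinf 1%N) T1 => [b| |] // T1.
      exists b => //; split=> /=; last by rewrite TE.
      by rewrite limit_jump_timesT.1 ltW.
    exists 1 => //; split=> /=; last by rewrite TE leey.
    by rewrite limit_jump_timesT.1 lee_fin.
  move=> V V0; have [d d0 dV] := limit_arc_near E0 V0.
  pose t := Num.min d b / 2.
  have [t0 tb td] : [/\ 0 < t, t < b & t < d].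
    have m0 : 0 < Num.min d b by rewrite lt_min d0.
    have tm : t < Num.min d b by rewrite /t; lra.
    split; first by rewrite divr_gt0.
      by apply: lt_le_trans tm _; rewrite ge_min lexx orbT.
    by apply: lt_le_trans tm _; rewrite ge_min lexx.
  have t0b : 0 < t < b by rewrite t0.
  have [Ct Et] := limit_arc_inner E0 Eb t0b.
  by exists (limit_arc t 0%N); split=> //; apply: dV => //; rewrite subr0 gtr0_norm.
- by move=> j _ t /int[a [b [Ea Eb atb]]]; case: (limit_arc_inner Ea Eb atb).
- by move=> j _; exact: limit_arc_flow.
- exact: limit_arc_jump.
Qed.

End limit_arc.

(** * The omega-limit set *)

Section omega_limit.
Variables (R : realType) (n : nat) (M : C1manifold R n).

(** The sequences of the definition are recovered from neighborhoods by a countable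
base. *)
Lemma omega_limitP (phi : partial_arc M) (x : M) : omega_limit phi x <->
  forall V (N : R), nbhs x V -> exists t j,
    [/\ arc_dom phi (t, j), N <= t + j%:R & V (phi t j)].
Proof.
split=> [[t [j [Etj tj tjx]]] V N xV|H].
  have VE : \forall i \near \oo, V (phi (t i) (j i)) := tjx _ xV.
  have NE : \forall i \near \oo, N <= t i + (j i)%:R.
    by move/cvgryPge : tj => /(_ N).
  by have [i [Vi Ni]] := filter_ex (filterI VE NE); exists (t i), (j i).
have [V [Vx Vbase]] := countable_nbhs_base x (@mfd_second_countable _ _ M).
have /choice[p pP] : forall k : nat, exists p : R * nat,
    [/\ arc_dom phi p, k%:R <= p.1 + p.2%:R & V k (phi p.1 p.2)].
  by move=> k; have [t [j [? ? ?]]] := H _ k%:R (Vx k); exists (t, j).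
exists (fun k => (p k).1), (fun k => (p k).2); split.
- by move=> k; case: (pP k) => + _ _; case: (p k).
- apply/cvgryPge => A; exists (Num.truncn A).+1 => // k /= Ak.
  have [_ kp _] := pP k; apply: le_trans kp; apply: ltW.
  by apply: lt_le_trans (Num.Theory.truncnS_gt A) _; rewrite ler_nat.
- move=> W /Vbase[k kW]; exists k => // l /= kl.
  by apply: (kW l kl); case: (pP l).
Qed.

Lemma omega_limit_closed (phi : partial_arc M) : closed (omega_limit phi).
Proof.
rewrite closedE => x clx; apply/omega_limitP => V N xV.
apply: contrapT => nV; apply: clx.
have := nbhs_interior xV; apply: filterS => y yV /omega_limitP yO; apply: nV.
exact: yO.
Qed.

Section precompact.
Variable phi : partial_arc M.
Hypothesis pphi : precompact_arc phi.
Hypothesis uphi : unbounded_domain (arc_dom phi).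

Lemma omega_limit_compact : compact (omega_limit phi).
Proof.
have [K phiK [cK clK]] := pphi.
apply: (subclosed_compact (omega_limit_closed (phi := phi)) cK) => x /omega_limitP xO.
apply: clK => V xV; have [t [j [Et _ Vt]]] := xO V 0 xV.
by exists (phi t j); split=> //; apply: phiK; exists (t, j).
Qed.

(** Points of the arc outside V at arbitrarily late times would have a cluster
point, in the omega-limit set but outside the open set V. *)
Lemma omega_limit_attracts (V : set M) : open V -> omega_limit phi `<=` V ->
  exists2 N : R, 0 < N & forall t j, arc_dom phi (t, j) -> N <= t + j%:R ->
    V (phi t j).
Proof.
move=> oV OV; apply: contrapT => nN.
have /choice[p pP] : forall k : nat, exists p : R * nat,
    [/\ arc_dom phi p, k%:R <= p.1 + p.2%:R & ~ V (phi p.1 p.2)].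
  move=> k; apply: contrapT => nk; apply: nN; exists k.+1%:R => // t j Et kt.
  apply: contrapT => nV; apply: nk; exists (t, j); split=> //=.
  by apply: le_trans kt; rewrite ler_nat.
have [K phiK [cK clK]] := pphi.
have [x [Kx clx]] : K `&` cluster ((fun k => phi (p k).1 (p k).2) @ \oo) !=set0.
  apply: cK; suff : \forall k \near \oo, K (phi (p k).1 (p k).2) by [].
  by apply: filterE => k; apply: phiK; exists (p k) => //; case: (pP k).
have freq W k : nbhs x W -> exists2 l, (k <= l)%N & W (phi (p l).1 (p l).2).
  move=> xW; have [] := clx ((fun k => phi (p k).1 (p k).2) @` [set l | (k <= l)%N]) W.
  - by exists k => // l /= kl; exists l.
  - exact: xW.
  - by move=> _ [[l /= kl <-] Wl]; exists l.
have xO : omega_limit phi x.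
  apply/omega_limitP => W N xW.
  have [l Nl Wl] := freq W (Num.truncn N).+1 xW.
  exists (p l).1, (p l).2; have [El lp _] := pP l; split=> //; first by case: (p l) El.
  apply: le_trans lp; apply: ltW; apply: lt_le_trans (Num.Theory.truncnS_gt N) _.
  by rewrite ler_nat.
have [l _ Vl] := freq V 0%N (open_nbhs_nbhs (conj oV (OV _ xO))).
by case: (pP l).
Qed.

Lemma omega_limit_nonempty : omega_limit phi !=set0.
Proof.
apply: contrapT => nO.
have [] := @omega_limit_attracts set0 open0; first by move=> x xO; case: nO; exists x.
by move=> N _ NP; have [[t j] Et /ltW/(NP _ _ Et)] := uphi N.
Qed.

End precompact.
End omega_limit.

Lemma ultra_bounded_nat (U : set_system nat) (b : nat -> nat) (B : nat) :
  UltraFilter U -> (\forall i \near U, (b i <= B)%N) ->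
  exists k, \forall i \near U, b i = k.
Proof.
move=> UF; elim: B => [|B ih] bB.
  by exists 0%N; apply: filterS bB => i; rewrite leqn0 => /eqP.
have [UB|UB] := in_ultra_setVsetC [set i | b i = B.+1] UF; first by exists B.+1.
apply: ih; apply: filterS2 bB UB => i; rewrite leq_eqVlt => /orP[/eqP //|].
by rewrite ltnS.
Qed.

(** Let S be t + j - N and i the last index with T i + i <= S. Then s is the time
at which s + i equals S, or T i.+1 if the i-th interval ends before that; jumps
have unit length, so at most 1 is lost. *)
Lemma domain_step_back (R : realType) (T : nat -> \bar R) (t N : R) (j : nat) :
  jump_times T -> jump_domain T (t, j) -> 0 <= N -> N <= t + j%:R ->
  exists s i, [/\ jump_domain T (s, i), s <= t, (i <= j)%N &
    N <= (t + j%:R) - (s + i%:R) <= N + 1].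
Proof.
move=> jT [/= Tt tT] N0 NS.
pose S := t + j%:R - N.
have fT i : (i <= j)%N -> T i \is a fin_num.
  move=> ij; rewrite ge0_fin_numE ?jump_times_ge0//.
  exact: le_lt_trans (le_trans (jump_times_mono jT ij) Tt) (ltry _).
pose Q i := (i <= j)%N && (fine (T i) + i%:R <= S).
have exQ : exists i, Q i by exists 0%N; rewrite /Q jT.1/= addr0 /S subr_ge0.
have ubQ i : Q i -> (i <= j)%N by case/andP.
case: (ex_maxnP exQ ubQ) => i /andP[ij TS] imax.
have [ij'|ji] := ltnP i j; last first.
  have E : i = j by apply/eqP; rewrite eqn_leq ij.
  rewrite E in TS; exists (t - N), j; split => //.
  - split=> /=; first by rewrite -(fineK (fT j _))// lee_fin; move: TS; rewrite /S; lra.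
    by apply: le_trans tT; rewrite lee_fin; lra.
  - lra.
  - by apply/andP; split; lra.
have Ti1 : fine (T i) <= fine (T i.+1).
  by apply: fine_le; rewrite ?fT//; exact: jT.2.
have Ti1t : fine (T i.+1) <= t.
  rewrite -lee_fin fineK ?fT//; exact: le_trans (jump_times_mono jT ij') Tt.
have Si : S < fine (T i.+1) + i.+1%:R.
  rewrite ltNge; apply/negP => h; have := imax i.+1; rewrite /Q ij' h => /(_ isT).
  by rewrite ltnn.
rewrite -natr1 in Si.
pose s := Num.min (fine (T i.+1)) (S - i%:R).
have sT : s <= fine (T i.+1) by rewrite ge_min lexx.
have sS : s <= S - i%:R by rewrite ge_min lexx orbT.
have Ts : fine (T i) <= s by rewrite le_min Ti1; lra.
have Ss : S - i%:R - 1 <= s by rewrite le_min; apply/andP; split; lra.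
exists s, i; split => //.
- by split=> /=; rewrite -[T _]fineK ?fT// lee_fin.
- exact: le_trans Ti1t.
- by move: sS Ss; rewrite /S => *; apply/andP; split; lra.
Qed.

Section invariance.
Variables (R : realType) (n : nat) (M : C1manifold R n) (H : hybrid_system M).
Hypothesis HH : hybrid_basic_conditions H.
Variable phi : partial_arc M.
Hypothesis solphi : solution H phi.
Hypothesis pphi : precompact_arc phi.
Hypothesis uphi : unbounded_domain (arc_dom phi).

(** The arcs are shifted to the origins (tt i, jj i). The differences s i - tt i
and k i - jj i are bounded, so along an ultrafilter the first converges to some a
and the second is eventually equal to some b; the limit arc takes the value xi at
(a, b). With c = d = 0 this point is the origin. *)
Theorem omega_limit_solution (tt s : nat -> R) (jj k : nat -> nat) (c d : R)
    (xi : M) :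
  (forall i, arc_dom phi (tt i, jj i)) -> (forall i, arc_dom phi (s i, k i)) ->
  (forall i, tt i <= s i) -> (forall i, (jj i <= k i)%N) ->
  (forall i, c <= (s i + (k i)%:R) - (tt i + (jj i)%:R) <= d) ->
  s i + (k i)%:R @[i --> \oo] --> +oo -> phi (s i) (k i) @[i --> \oo] --> xi ->
  exists (gamma : partial_arc M) a b,
    [/\ solution H gamma, unbounded_domain (arc_dom gamma),
        forall t j, arc_dom gamma (t, j) -> omega_limit phi (gamma t j),
        arc_dom gamma (a, b) /\ gamma a b = xi & c <= a + b%:R <= d].
Proof.
move=> Ett Es tts jjk cd soo sxi.
have hphi := (solution_arc solphi).1.
have [T jT domT] := domain_jump_times hphi uphi.
have [U [UF ooU]] := ultraFilterLemma eventually_filter.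
have [a aI acvg] : exists2 a, `[0, d]%classic a & (s i - tt i) @[i --> U] --> a.
  apply: compact_ultra_cvg; first exact: segment_compact.
  apply: filterE => i /=; rewrite in_itv/= subr_ge0 tts/=.
  have /andP[_ +] := cd i; have : (jj i)%:R <= (k i)%:R :> R by rewrite ler_nat.
  by lra.
have [b bE] : exists b, \forall i \near U, (k i - jj i)%N = b.
  apply: (@ultra_bounded_nat _ _ (Num.truncn d)); apply: filterE => i.
  have d0 : (k i - jj i)%:R <= d.
    by rewrite natrB//; have /andP[_ +] := cd i; have := tts i; lra.
  by rewrite truncn_ge_nat// (le_trans _ d0).
have kE : \forall i \near U, k i = (jj i + b)%N.
  by apply: filterS bE => i <-; rewrite subnKC.
have sE i : tt i + (s i - tt i) = s i by rewrite addrC subrK.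
have gl : graph_limit phi tt jj U a b xi.
  exists (fun i => s i - tt i); split=> //.
    apply: filterS kE => i ki; rewrite subr_ge0 sE -ki; split => //; exact: Es.
  have sxiU : phi (s i) (k i) @[i --> U] --> xi by move=> V /sxi; exact: ooU.
  apply: cvg_trans sxiU; apply: near_eq_cvg.
  by apply: filterS kE => i ki; rewrite sE -ki.
pose gamma := limit_arc phi T tt jj U.
have [ugamma solgamma] := limit_arc_solution HH solphi pphi jT domT Ett UF.
exists gamma, a, b; split=> //.
- move=> t j /(limit_arcP HH solphi pphi jT domT Ett UF)[e [et eE ecvg]].
  apply/omega_limitP => V N tV.
  have VE : \forall i \near U, V (phi (tt i + e i) (jj i + j)%N) := ecvg _ tV.
  have NE : \forall i \near U, N + d <= s i + (k i)%:R.
    by apply: ooU; move/cvgryPge : soo; exact.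
  have [i [[e0 Ei] [Vi Ni]]] := filter_ex (filterI eE (filterI VE NE)).
  exists (tt i + e i), (jj i + j)%N; split=> //.
  rewrite natrD; have := ler0n R j; have /andP[_] := cd i; lra.
- split; first exact: (graph_limit_dom domT UF gl).
  exact: (limit_arcE HH solphi pphi T UF gl).
- have lim : (s i - tt i) + b%:R @[i --> U] --> a + b%:R.
    by apply: cvgD => //; exact: cvg_cst.
  have E : \forall i \near U, c <= (s i - tt i) + b%:R <= d.
    apply: filterS kE => i ki; have := cd i; rewrite ki natrD.
    by move=> /andP[? ?]; apply/andP; split; lra.
  apply/andP; split.
    by apply: (cvgr_to_ge lim); apply: filterS E => i /andP[].
  by apply: (cvgr_to_le lim); apply: filterS E => i /andP[].
Qed.

Lemma unbounded_solution_maximal (gamma : partial_arc M) :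
  solution H gamma -> unbounded_domain (arc_dom gamma) ->
  complete_arc gamma /\ maximal_solution H gamma.
Proof.
move=> solg ug; have cg : complete_arc gamma.
  by apply/complete_unbounded => //; exact: (solution_arc solg).1.
by split=> //; exact: complete_solution_maximal.
Qed.

Lemma omega_limit_forward : weakly_forward_invariant H (omega_limit phi).
Proof.
split=> [|xi [t [j [Etj tj tjx]]]]; first exact: omega_limit_nonempty.
have [||i|gamma [a [b [solg ug gO [Eab gab] ab]]]] :=
  @omega_limit_solution t t j j 0 0 xi Etj Etj _ _ _ tj tjx => //.
  by rewrite subrr lexx.
have [cg mg] := unbounded_solution_maximal solg ug.
have a0 : 0 <= a := domain_ge0 (solution_arc solg).1 Eab.
have b0 := ler0n R b.
have aE : a = 0 by lra.
have bE : b = 0%N by apply/eqP; rewrite -(eqr_nat R); apply/eqP; lra.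
exists gamma; split=> //.
  by split=> //=; rewrite -gab aE bE.
by move=> _ [[u l] Eul <-]; exact: gO.
Qed.

Lemma omega_limit_backward : weakly_backward_invariant H (omega_limit phi).
Proof.
split=> [|xi N /omega_limitP xiO N0]; first exact: omega_limit_nonempty.
have xO : omega_limit phi xi by exact/omega_limitP.
case: xO => t [j [Etj tj tjx]].
have [T jT domT] := domain_jump_times (solution_arc solphi).1 uphi.
have [m _ mN] : \forall i \near \oo, N <= t i + (j i)%:R.
  by move/cvgryPge : tj; exact.
have /choice[p pP] : forall i, exists p : R * nat,
    [/\ arc_dom phi p, p.1 <= t (m + i)%N, (p.2 <= j (m + i))%N &
     N <= (t (m + i)%N + (j (m + i)%N)%:R) - (p.1 + p.2%:R) <= N + 1].
  move=> i; have Ei : jump_domain T (t (m + i)%N, j (m + i)%N) by rewrite -domT.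
  have [s [l [? ? ? ?]]] := domain_step_back jT Ei (ltW N0) (mN _ (leq_addr _ _)).
  by exists (s, l); split=> //; rewrite domT.
have shift_cvg (X : topologicalType) (f : nat -> X) (F : set_system X) :
    f i @[i --> \oo] --> F -> f (m + i)%N @[i --> \oo] --> F.
  move=> fF W /fF[q _ qW]; exists q => // i /= qi; apply: qW => /=.
  exact: leq_trans qi (leq_addl _ _).
have [|||||||gamma [a [b [solg ug gO [Eab gab] /andP[ab _]]]]] :=
  @omega_limit_solution (fun i => (p i).1) (fun i => t (m + i)%N) (fun i => (p i).2)
    (fun i => j (m + i)%N) N (N + 1) xi.
- by move=> i; case: (pP i) => + _ _ _; case: (p i).
- by move=> i; exact: Etj.
- by move=> i; case: (pP i).
- by move=> i; case: (pP i).
- by move=> i; case: (pP i).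
- exact: (shift_cvg _ (fun i => t i + (j i)%:R)).
- exact: (shift_cvg _ (fun i => phi (t i) (j i))).
have [cg mg] := unbounded_solution_maximal solg ug.
exists gamma, a, b; split=> //; last by move=> u l Eul _; exact: gO.
by split=> //; apply: gO; exact: domain_origin (solution_arc solg).1.
Qed.

End invariance.

Theorem mainTheorem4 (R : realType) (n : nat) (M : C1manifold R n)
    (H : hybrid_system M) (phi : partial_arc M) :
  hybrid_basic_conditions H ->
  solution H phi ->
  complete_arc phi ->
  precompact_arc phi ->
  [/\ omega_limit phi !=set0,
      compact (omega_limit phi),
      weakly_invariant H (omega_limit phi) &
      forall U : set M, open U -> omega_limit phi `<=` U ->
        exists2 N : R, 0 < N &
          forall (t : R) (j : nat), arc_dom phi (t, j) -> N <= t + j%:R ->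
            U (phi t j)].
Proof.
move=> HH solphi cphi pphi.
have uphi : unbounded_domain (arc_dom phi).
  by apply/complete_unbounded => //; exact: (solution_arc solphi).1.
split.
- exact: omega_limit_nonempty.
- exact: omega_limit_compact.
- by split; [exact: omega_limit_forward|exact: omega_limit_backward].
- by move=> U; exact: omega_limit_attracts.
Qed.
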